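(* Let $(M,\omega)$ be any symplectic manifold and let $N\subset M$ be a submanifold which is closed as a subset and which is not coisotropic. Then $N$ is not CH-rigid. (In particular, if $N$ is a compact submanifold of a geometrically bounded symplectic manifold and $N$ is CH-rigid, then $N$ is coisotropic.)
   Context: All manifolds and submanifolds are without boundary; submanifolds are embedded. For a symplectic manifold $(M,\omega)$, a compactly supported smooth function $H\colon[0,1]\times M\to\mathbb{R}$ determines a time-dependent Hamiltonian vector field by $\omega(\cdot,X_{H_t})=d(H(t,\cdot))$; its time-one map is denoted $\phi_H^1$. $Ham(M,\omega)$ is the group of all such time-one maps. The Hofer norm is $\|\phi\|=\inf\{\int_0^1(\max_M H(t,\cdot)-\min_M H(t,\cdot))\,dt : \phi_H^1=\phi\}$. For a closed subset $N\subset M$, $\mathcal{L}(N)=\{\phi(N):\phi\in Ham(M,\omega)\}$, and the Chekanov--Hofer pseudometric on $\mathcal{L}(N)$ is $\delta(N_0,N_1)=\inf\{\|\phi\|:\phi\in Ham(M,\omega),\ \phi(N_0)=N_1\}$. $N$ is CH-rigid if $\delta$ is a nondegenerate metric on $\mathcal{L}(N)$. For a subspace $U$ of a symplectic vector space, $U^\omega$ is its $\omega$-orthogonal complement; $N$ is coisotropic if $T_xN^\omega\subset T_xN$ for all $x\in N$. $(M,\omega)$ is geometrically bounded if there are an almost complex structure $\hat J$ and a complete Riemannian metric $\langle\cdot,\cdot\rangle$ on $M$, with sectional curvature bounded above and injectivity radius bounded away from zero, and constants $c_1,c_2>0$ such that $\omega(v,\hat Jv)\ge c_1\langle v,v\rangle$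 and $|\omega(v,w)|^2\le c_2\langle v,v\rangle\langle w,w\rangle$ for all $m\in M$, $v,w\in T_mM$. *)

(* Defs.v *)
From HB Require Import structures.
From mathcomp Require Import all_boot all_order all_algebra.
From mathcomp Require Import all_classical all_reals all_analysis.

Set Implicit Arguments.
Unset Strict Implicit.
Unset Printing Implicit Defensive.

Import Order.TTheory GRing.Theory Num.Theory.
Import numFieldNormedType.Exports.

Local Open Scope classical_set_scope.
Local Open Scope ring_scope.

Section Smooth.
Context {R : realType} {V W : normedModType R}.

Fixpoint times_differentiable_on (k : nat) (U : set V) (f : V -> W) : Prop :=
  if k is k'.+1 then
    (forall x, U x -> differentiable f x) /\
    (forall v, times_differentiable_on k' U (fun x => 'd f x v))
  else True.

(* Meant for V finite-dimensional and U open: f is then of class C^oo on U.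
   The values of f outside U are irrelevant. *)
Definition smooth_on (U : set V) (f : V -> W) : Prop :=
  forall k, times_differentiable_on k U f.

End Smooth.

(* A chart and its inverse, as total functions: the values of chart_map outside
   chart_dom, and of chart_inv outside chart_im, are irrelevant. *)
Record chart (R : realType) (m : nat) (T : Type) := Chart {
  chart_dom : set T;
  chart_map :> T -> 'rV[R]_m;
  chart_inv : 'rV[R]_m -> T }.

Section Charts.
Context {R : realType} {m : nat} {T : topologicalType}.
Implicit Types c : chart R m T.

Definition chart_im c : set 'rV[R]_m := c @` chart_dom c.

Definition is_chart c : Prop :=
  [/\ open (chart_dom c),
      open (chart_im c),
      (forall p, chart_dom c p -> {for p, continuous c}),
      (forall x, chart_im c x -> {for x, continuous (chart_inv c)}) &
      (forall p, chart_dom c p -> chart_inv c (c p) = p)].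

Definition transition c c' : 'rV[R]_m -> 'rV[R]_m := c' \o chart_inv c.

Definition compatible c c' : Prop :=
  smooth_on (c @` (chart_dom c `&` chart_dom c')) (transition c c') /\
  smooth_on (c' @` (chart_dom c `&` chart_dom c')) (transition c' c).

End Charts.

Record manifold (R : realType) (m : nat) := Manifold {
  carrier :> topologicalType;
  atlas : set (chart R m carrier);
  manifold_hausdorff : hausdorff_space carrier;
  manifold_second_countable : @second_countable carrier;
  atlas_chart : forall c, atlas c -> is_chart c;
  atlas_cover : forall p : carrier, exists2 c, atlas c & chart_dom c p;
  atlas_compatible : forall c c', atlas c -> atlas c' -> compatible c c';
  atlas_maximal : forall c, is_chart c ->
    (forall c', atlas c' -> compatible c c') -> atlas c }.

Section Manifolds.
Context {R : realType} {m : nat} (M : manifold R m).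
Local Notation E := 'rV[R]_m.
Local Notation chartM := (chart R m M).

Definition chart_at (p : M) : set chartM :=
  [set c | atlas c /\ chart_dom c p].

(* A tangent vector at p is represented by its coordinates u : E in a chart c
   at p; passing from c to c' replaces u by [change_coord c c' p u]. *)
Definition change_coord (c c' : chartM) (p : M) (u : E) : E :=
  'd (transition c c') (c p) u.

(* If tau is a tensor field, tau c p u v is the value of tau at p on the tangent
   vectors whose coordinates in the chart c are u and v; only the values for c
   in [chart_at p] are meaningful. *)
Definition cotensor2 := chartM -> M -> E -> E -> R.
Definition endotensor := chartM -> M -> E -> E.

Definition is_cotensor2 (tau : cotensor2) : Prop :=
  [/\ (forall p c, chart_at p c -> forall a u v w,
         tau c p (a *: u + v) w = a * tau c p u w + tau c p v w /\
         tau c p w (a *: u + v) = a * tau c p w u + tau c p w v),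
      (forall p c c', chart_at p c -> chart_at p c' -> forall u v,
         tau c' p (change_coord c c' p u) (change_coord c c' p v) =
         tau c p u v) &
      (forall c, atlas c -> forall u v,
         smooth_on (chart_im c)
           (fun x => tau c (chart_inv c x) u v : R^o))].

Definition is_endotensor (J : endotensor) : Prop :=
  [/\ (forall p c, chart_at p c -> forall a u v,
         J c p (a *: u + v) = a *: J c p u + J c p v),
      (forall p c c', chart_at p c -> chart_at p c' -> forall u,
         J c' p (change_coord c c' p u) = change_coord c c' p (J c p u)) &
      (forall c, atlas c -> forall u,
         smooth_on (chart_im c) (fun x => J c (chart_inv c x) u))].

(* The derivative at p, in the direction u, of v' |-> tau(v, w) where v and w
   are extended to vector fields with constant coordinates in c. *)
Definition dtensor (tau : cotensor2) (c : chartM) (p : M) (u v w : E) : R :=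
  'd (fun x : E => tau c (chart_inv c x) v w : R^o) (c p) u.

Definition symplectic_form (om : cotensor2) : Prop :=
  [/\ is_cotensor2 om,
      (forall p c, chart_at p c -> forall u, om c p u u = 0),
      (forall p c, chart_at p c -> forall u v w,
         dtensor om c p u v w - dtensor om c p v u w
         + dtensor om c p w u v = 0) &
      (forall p c, chart_at p c -> forall u,
         (forall v, om c p u v = 0) -> u = 0)].

Definition embedded_submanifold (k : nat) (N : set M) : Prop :=
  (k <= m)%N /\
  forall p, N p -> exists2 c, chart_at p c &
    forall q, chart_dom c q -> N q <-> (forall i : 'I_m, (k <= i)%N -> c q 0 i = 0).

(* T_pN in the coordinates of c: the velocities of smooth curves in N. *)
Definition tangent_space (N : set M) (c : chartM) (p : M) : set E :=
  [set v | exists (gam : R -> M) (e : R),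
     [/\ 0 < e, gam 0 = p,
         (forall t, `|t| < e -> N (gam t) /\ chart_dom c (gam t)),
         smooth_on [set t : R^o | `|t| < e] (c \o gam : R^o -> E) &
         derive1 (c \o gam) 0 = v]].

Definition omega_orthogonal (om : cotensor2) (c : chartM) (p : M)
    (U : set E) : set E :=
  [set v | forall u, U u -> om c p v u = 0].

Definition coisotropic (om : cotensor2) (N : set M) : Prop :=
  forall p, N p -> forall c, chart_at p c ->
    omega_orthogonal om c p (tangent_space N c p) `<=` tangent_space N c p.

(* Smooth on [0, 1] x M, a manifold with boundary: in charts, H locally extends
   to a smooth function on an open subset of R x E. *)
Definition smooth_hamiltonian (H : R -> M -> R) : Prop :=
  forall c, atlas c -> forall t x, t \in `[0, 1] -> chart_im c x ->
  exists (W : set (R^o * E)) (F : R^o * E -> R^o),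
    [/\ open W, W (t, x), smooth_on W F &
        forall s y, W (s, y) -> s \in `[0, 1] -> chart_im c y ->
          F (s, y) = H s (chart_inv c y)].

Definition compactly_supported (H : R -> M -> R) : Prop :=
  compact (closure [set z : R * M | z.1 \in `[0, 1] /\ H z.1 z.2 != 0]).

Definition hamiltonian_vector (om : cotensor2) (h : M -> R)
    (c : chartM) (p : M) (X : E) : Prop :=
  forall v, om c p v X = 'd (h \o chart_inv c : E -> R^o) (c p) v.

(* At t = 0 and t = 1 the limit is one-sided. *)
Definition hamiltonian_isotopy (om : cotensor2) (H : R -> M -> R)
    (Phi : R -> M -> M) : Prop :=
  forall p, [/\ Phi 0 p = p,
    {within `[0, 1], continuous (fun t => Phi t p)} &
    forall t, t \in `[0, 1] -> forall c, chart_at (Phi t p) c ->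
      exists2 X, hamiltonian_vector om (H t) c (Phi t p) X &
        h^-1 *: (c (Phi (t + h) p) - c (Phi t p))
          @[h --> within [set h | t + h \in `[0, 1]] 0^'] --> X].

Definition time_one_map (om : cotensor2) (H : R -> M -> R)
    (phi : M -> M) : Prop :=
  exists2 Phi, hamiltonian_isotopy om H Phi & Phi 1 = phi.

Definition generates (om : cotensor2) (H : R -> M -> R)
    (phi : M -> M) : Prop :=
  [/\ smooth_hamiltonian H, compactly_supported H & time_one_map om H phi].

Definition Ham (om : cotensor2) : set (M -> M) :=
  [set phi | exists H, generates om H phi].

(* For compactly supported H the sup and the inf are attained. *)
Definition oscillation (h : M -> R) : R := sup (range h) - inf (range h).

Definition hofer_norm (om : cotensor2) (phi : M -> M) : \bar R :=
  ereal_inf [set (\int[lebesgue_measure]_(t in `[0%R, 1%R])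
                    (oscillation (H t))%:E)%E
            | H in [set H | generates om H phi]].

Definition ham_orbit (om : cotensor2) (N : set M) : set (set M) :=
  [set phi @` N | phi in Ham om].

Definition chekanov_hofer (om : cotensor2) (N0 N1 : set M) : \bar R :=
  ereal_inf [set hofer_norm om phi
            | phi in [set phi | Ham om phi /\ phi @` N0 = N1]].

(* [chekanov_hofer om] is always a pseudometric on [ham_orbit om N], so only
   nondegeneracy is at stake. *)
Definition CH_rigid (om : cotensor2) (N : set M) : Prop :=
  forall N0 N1, ham_orbit om N N0 -> ham_orbit om N N1 ->
    chekanov_hofer om N0 N1 = 0%E -> N0 = N1.

Definition almost_complex_structure (J : endotensor) : Prop :=
  is_endotensor J /\
  forall p c, chart_at p c -> forall u, J c p (J c p u) = - u.

Definition riemannian_metric (g : cotensor2) : Prop :=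
  [/\ is_cotensor2 g,
      (forall p c, chart_at p c -> forall u v, g c p u v = g c p v u) &
      (forall p c, chart_at p c -> forall u, u != 0 -> 0 < g c p u u)].

Definition gram_matrix (g : cotensor2) (c : chartM) (p : M) : 'M[R]_m :=
  \matrix_(i, j) g c p (delta_mx 0 i) (delta_mx 0 j).

(* Levi-Civita derivative of v along u, both with constant coordinates in c:
   the solution of the Koszul formula
   2 g(christoffel u v, w) = D_u g(v, w) + D_v g(u, w) - D_w g(u, v). *)
Definition christoffel (g : cotensor2) (c : chartM) (p : M) (u v : E) : E :=
  (\row_l (2^-1 * (dtensor g c p u v (delta_mx 0 l)
                   + dtensor g c p v u (delta_mx 0 l)
                   - dtensor g c p (delta_mx 0 l) u v)))
  *m invmx (gram_matrix g c p).

(* R(u, v)w = nabla_u nabla_v w - nabla_v nabla_u w - nabla_[u, v] w. *)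
Definition curvature (g : cotensor2) (c : chartM) (p : M) (u v w : E) : E :=
  let Gam := christoffel g c p in
  let dGam a b1 b2 :=
    'd (fun x : E => christoffel g c (chart_inv c x) b1 b2) (c p) a in
  dGam u v w - dGam v u w + Gam u (Gam v w) - Gam v (Gam u w).

Definition gram_det (g : cotensor2) (c : chartM) (p : M) (u v : E) : R :=
  g c p u u * g c p v v - g c p u v ^+ 2.

Definition sectional_curvature (g : cotensor2) (c : chartM) (p : M)
    (u v : E) : R :=
  g c p (curvature g c p u v v) u / gram_det g c p u v.

Definition sectional_curvature_bounded_above (g : cotensor2) : Prop :=
  exists K : R, forall p c, chart_at p c -> forall u v,
    gram_det g c p u v != 0 -> sectional_curvature g c p u v <= K.

Definition geodesic (g : cotensor2) (gam : R -> M) : Prop :=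
  continuous gam /\
  forall t c, chart_at (gam t) c ->
    derivable (c \o gam : R -> E) t 1 /\
    is_derive t 1 (derive1 (c \o gam : R -> E))
      (- christoffel g c (gam t) (derive1 (c \o gam) t)
                                 (derive1 (c \o gam) t)).

Definition geodesic_from (g : cotensor2) (c : chartM) (p : M) (v : E)
    (gam : R -> M) : Prop :=
  [/\ geodesic g gam, gam 0 = p & derive1 (c \o gam) 0 = v].

Definition complete_metric (g : cotensor2) : Prop :=
  forall p c, chart_at p c -> forall v, exists gam, geodesic_from g c p v gam.

(* exp_p is a diffeomorphism from the ball of radius r in T_pM, in the
   coordinates of c, onto an open set; its inverse is then a chart c' of the
   maximal atlas. *)
Definition exp_diffeo_on_ball (g : cotensor2) (p : M) (r : R) : Prop :=
  forall c, chart_at p c -> exists2 c', atlas c' &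
    chart_im c' = [set v | g c p v v < r ^+ 2] /\
    forall v, chart_im c' v ->
      exists2 gam, geodesic_from g c p v gam & gam 1 = chart_inv c' v.

Definition injectivity_radius (g : cotensor2) (p : M) : \bar R :=
  ereal_sup [set r%:E | r in [set r : R | 0 < r /\ exp_diffeo_on_ball g p r]].

Definition geometrically_bounded (om : cotensor2) : Prop :=
  exists (J : endotensor) (g : cotensor2),
    [/\ almost_complex_structure J,
        riemannian_metric g /\ complete_metric g,
        sectional_curvature_bounded_above g,
        (exists2 r : R, 0 < r & forall p, (r%:E <= injectivity_radius g p)%E) &
        exists c1 c2 : R, [/\ 0 < c1, 0 < c2 &
          forall p c, chart_at p c -> forall v w,
            c1 * g c p v v <= om c p v (J c p v) /\
            `|om c p v w| ^+ 2 <= c2 * g c p v v * g c p w w]].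

End Manifolds.

(* Main.v *)
Require Import Defs.
From HB Require Import structures.
From mathcomp Require Import all_boot all_order all_algebra.
From mathcomp Require Import all_classical all_reals all_analysis.
From mathcomp Require Import perm ring lra.

(** Suppose that [N] is not coisotropic at a point [p].  Then some vector [v] at
    [p] is symplectically orthogonal to [T_pN] but not tangent to [N].  In a
    slice chart around [p] the linear form [om(., v)] vanishes along [N]; times
    a bump function it gives a compactly supported Hamiltonian [h] which is zero
    on [N] and whose Hamiltonian field at [p] is a positive multiple of [v].
    The integral curve of that field through [p] starts transversally to [N],
    so at some small time [s] it is outside [N].

    The point is that the image of [N] under the flow of [h] can be reached at
    arbitrarily small cost.  For [e > 0] replace [h] by
    [wave s e \o h = s e sin (h / e)].  Its Hamiltonian field is
    [s cos (h / e)] times that of [h].  As [h] is constant along its own integral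
    curves, the factor [s cos (h / e)] is constant along each curve: the new flow
    is the old one run at a speed depending only on the value of [h]
    ([profile_isotopy]).  On [N], where [h = 0], this speed is [s] whatever [e]
    is.  Hence the time-one maps all send [N] to the same set [N1], and [N1] is
    not [N].  But the oscillation of [s e sin (h / e)] is at most [2 |s| e], so
    the Chekanov--Hofer distance between [N] and [N1] is zero
    ([not_CH_rigid]).

    The analytic ingredients are a calculus of iterated differentiability
    ([Ck_comp], [Ck_invmx]), a smooth bump built from [exp (- 1 / t)], the
    Picard--Lindelof theorem ([picard_lindelof], [local_flow]), and Cramer's rule
    to solve [om(., X) = dh] smoothly ([smooth_hamiltonian_field]).  The reduction
    to a slice chart is [noncoisotropic_slice]; the extension of chart functions
    to the manifold is the object of [extend_smooth] and [extend_vector]. *)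

Set Implicit Arguments.
Unset Strict Implicit.
Unset Printing Implicit Defensive.

Import Order.TTheory GRing.Theory Num.Theory.
Import numFieldNormedType.Exports.

Local Open Scope classical_set_scope.
Local Open Scope ring_scope.

(** * Calculus of k times differentiable maps *)

Section SmoothCalculus.
Context {R : realType}.
Implicit Types (V W Z : normedModType R).

(** The first-order expansion at [x] only sees the germ of the map at [x]. *)
Lemma near_eq_is_diff V W (f g : V -> W) (x : V) (df : V -> W) :
  {near x, f =1 g} -> is_diff x f df -> is_diff x g df.
Proof.
move=> fg [fx <-]; have fgx : f x = g x by exact: nbhs_singleton fg.
have dgE : g \o shift x = cst (g x) + 'd f x +o_ 0 id.
  apply/eqaddoP => e e0.
  have /eqaddoP/(_ e e0) := diff_locally fx.
  have : \forall h \near (0 : V), f (h + x) = g (h + x).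
    by have := fg; rewrite [X in X -> _](near_shift 0) subr0.
  apply: filterS2 => h fgh.
  by rewrite /= !fctE/= -fgh -fgx.
have dfc : continuous ('d f x) by exact: diff_continuous.
have E := diff_unique dfc dgE.
split; last exact: E.
by apply/diff_locallyP; split; rewrite E.
Qed.

(** Differentiating a bilinear map on the product space is how Leibniz' rule is
    obtained below for scaling in an arbitrary normed module. *)
Lemma scale_bilinear W : bilinear_for
    (GRing.Scale.Law.clone _ _ *:%R _) (GRing.Scale.Law.clone _ _ *:%R _)
    (fun (a : R^o) (w : W) => a *: w).
Proof.
split=> [w|r] a x y /=; first by rewrite scalerDl scalerA.
by rewrite scalerDr !scalerA mulrC.
Qed.

Lemma is_diff_scale V W (f df : V -> R^o) (g dg : V -> W) (x : V) :
  is_diff x f df -> is_diff x g dg ->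
  is_diff x (fun y => f y *: g y) (fun v => f x *: dg v + df v *: g x).
Proof.
move=> fx gx.
pose bM := bilinear_isBilinear.Build R R^o W W _ _ _ (scale_bilinear W).
pose b : {bilinear R^o -> W -> W} := HB.pack (fun (a : R^o) (w : W) => a *: w) bM.
have cb : continuous (fun p : R^o * W => b p.1 p.2).
  by move=> p; apply: scale_continuous.
pose s (p : R^o * W) := b p.1 p.2.
have ds p : is_diff p s (fun q => b p.1 q.2 + b q.1 p.2).
  split; first exact: differentiable_bilin.
  exact: diff_bilin.
exact: is_diff_eq (is_diff_comp (is_diff_pair fx gx) (ds (f x, g x))) _.
Qed.

Section Fixed.
Variables (V : normedModType R) (U : set V).
Hypothesis openU : open U.

(** [times_differentiable_on k.+1] speaks of the chosen differential ['d f x v]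
    at every [x], inside and outside [U]. This lemma is the way to work with a
    formula for the differential that is only valid on [U]; the induction is on
    [k] for all maps at once, because replacing the differential by the formula
    has to be repeated at each order. *)
Lemma Ck_succ W k (f : V -> W) (df : V -> V -> W) :
  (forall x, U x -> is_diff x f (df x)) ->
  (forall v, times_differentiable_on k U (df ^~ v)) ->
  times_differentiable_on k.+1 U f.
Proof.
elim: k W f df => [|k IH] W f df dfE Cdf; (split; first by move=> x /dfE[]).
  by [].
move=> v; have [dv Cv] := Cdf v.
apply: (IH _ _ (fun x => 'd (df ^~ v) x)) => // x Ux.
  apply: near_eq_is_diff (differentiableP (dv x Ux)).
  near=> y; have Uy : U y by near: y; exact: open_nbhs_nbhs.
  by have [_ ->] := dfE _ Uy.
Unshelve. all: by end_near. Qed.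

Lemma Ck_ext W k (f g : V -> W) : (forall x, U x -> f x = g x) ->
  times_differentiable_on k U f -> times_differentiable_on k U g.
Proof.
case: k => [//|k] fg [df Cf].
apply: (@Ck_succ _ _ _ (fun x => 'd f x)) => // x Ux.
apply: near_eq_is_diff (differentiableP (df x Ux)).
near=> y; apply: fg; near: y; exact: open_nbhs_nbhs.
Unshelve. all: by end_near. Qed.

Lemma Ck_pred W k (f : V -> W) :
  times_differentiable_on k.+1 U f -> times_differentiable_on k U f.
Proof.
elim: k W f => [//|k IH] W f [df Cf]; split=> // v.
by apply: IH.
Qed.

Lemma Ck_cst W k (a : W) : times_differentiable_on k U (fun=> a).
Proof.
elim: k W a => [//|k IH] W a.
by apply: (@Ck_succ _ _ _ (fun _ _ => 0)) => v; exact: IH.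
Qed.

Lemma CkD W k (f g : V -> W) :
  times_differentiable_on k U f -> times_differentiable_on k U g ->
  times_differentiable_on k U (fun x => f x + g x).
Proof.
elim: k W f g => [//|k IH] W f g [df Cf] [dg Cg].
apply: (@Ck_succ _ _ _ (fun x v => 'd f x v + 'd g x v)) => [x Ux|v].
  by apply: is_diffD; apply/differentiableP; [exact: df|exact: dg].
exact: (IH _ _ _ (Cf v) (Cg v)).
Qed.

Lemma Ck_lin W Z k (l : {linear W -> Z}) (f : V -> W) : continuous l ->
  times_differentiable_on k U f -> times_differentiable_on k U (l \o f).
Proof.
move=> cl; elim: k f => [//|k IH] f [df Cf].
apply: (@Ck_succ _ _ _ (fun x v => l ('d f x v))) => [x Ux|v]; last first.
  exact: (IH _ (Cf v)).
apply: is_diff_comp; first by apply/differentiableP; exact: df.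
by split; [exact: linear_differentiable|rewrite diff_lin].
Qed.

Lemma CkZ W k (f : V -> R^o) (g : V -> W) :
  times_differentiable_on k U f -> times_differentiable_on k U g ->
  times_differentiable_on k U (fun x => f x *: g x).
Proof.
elim: k W f g => [//|k IH] W f g Cf Cg; have [df Cdf] := Cf; have [dg Cdg] := Cg.
apply: (@Ck_succ _ _ _ (fun x v => f x *: 'd g x v + 'd f x v *: g x)) => [x Ux|v].
  by apply: is_diff_scale; apply/differentiableP; [exact: df|exact: dg].
exact: (CkD (IH _ _ _ (Ck_pred Cf) (Cdg v)) (IH _ _ _ (Cdf v) (Ck_pred Cg))).
Qed.

Lemma CkM k (f g : V -> R^o) :
  times_differentiable_on k U f -> times_differentiable_on k U g ->
  times_differentiable_on k U (fun x => f x * g x : R^o).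
Proof.
exact: (@CkZ R^o).
Qed.

Lemma CkV k (f : V -> R^o) : (forall x, U x -> f x != 0) ->
  times_differentiable_on k U f ->
  times_differentiable_on k U (fun x => (f x)^-1 : R^o).
Proof.
move=> f0; elim: k => [//|k IH] Cf; have [df Cdf] := Cf.
apply: (@Ck_succ _ _ _ (fun x v => (-1) * ((f x)^-1 * (f x)^-1 * 'd f x v))).
  move=> x Ux; split; first by apply: differentiableV; [exact: df|exact: f0].
  rewrite diffV; [|exact: df|exact: f0]; apply/funext => v /=.
  by rewrite mulN1r -invfM -expr2 [_ *: _ ]mulNr.
have IH' := IH (Ck_pred Cf).
move=> v; exact: (CkM (Ck_cst k (-1 : R^o)) (CkM (CkM IH' IH') (Cdf v))).
Qed.

Lemma Ck_sum k (I : Type) (r : seq I) (P : pred I) W (f : I -> V -> W) :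
  (forall i, P i -> times_differentiable_on k U (f i)) ->
  times_differentiable_on k U (fun x => \sum_(i <- r | P i) f i x).
Proof.
move=> Cf; elim: r => [|i r IH].
  by apply: Ck_ext (Ck_cst _ (0 : W)) => x _; rewrite big_nil.
case Pi: (P i).
  apply: Ck_ext (CkD (Cf i Pi) IH) => x _.
  by rewrite big_cons Pi.
by apply: Ck_ext IH => x _; rewrite big_cons Pi.
Qed.

Lemma Ck_prod k (I : Type) (r : seq I) (P : pred I) (f : I -> V -> R^o) :
  (forall i, P i -> times_differentiable_on k U (f i)) ->
  times_differentiable_on k U (fun x => \prod_(i <- r | P i) f i x : R^o).
Proof.
move=> Cf; elim: r => [|i r IH].
  by apply: Ck_ext (Ck_cst _ (1 : R^o)) => x _; rewrite big_nil.
case Pi: (P i).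
  apply: Ck_ext (CkM (Cf i Pi) IH) => x _.
  by rewrite big_cons Pi.
by apply: Ck_ext IH => x _; rewrite big_cons Pi.
Qed.

Lemma Ck_det n k (A : V -> 'M[R]_n) :
  (forall i j, times_differentiable_on k U (fun x => A x i j : R^o)) ->
  times_differentiable_on k U (fun x => \det (A x) : R^o).
Proof.
move=> CA; apply: (@Ck_sum _ _ _ _ R^o
  (fun (s : {perm 'I_n}) x => (-1) ^+ s * \prod_i A x i (s i) : R^o)) => s _.
apply: (CkM (Ck_cst k ((-1) ^+ s : R^o))).
by apply: (@Ck_prod _ _ _ _ (fun i x => A x i (s i) : R^o)) => i _; exact: CA.
Qed.

End Fixed.

Lemma Ck_sub V W k (U U' : set V) (f : V -> W) :
  U' `<=` U -> times_differentiable_on k U f -> times_differentiable_on k U' f.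
Proof.
move=> sU; elim: k f => [//|k IH] f [df Cf]; split=> [x /sU|v]; first exact: df.
exact: (IH _ (Cf v)).
Qed.

(** When the inner map has a constant differential [l], the differential of the
    composite in the direction [v] is ['d f . (l v)] composed with the same
    inner map, so the induction needs no product rule and no basis. *)
Lemma Ck_comp_affine V W Z k (U : set W) (a : V -> W) (l : V -> W) (f : W -> Z) :
  open (a @^-1` U) -> (forall x, is_diff x a l) ->
  times_differentiable_on k U f ->
  times_differentiable_on k (a @^-1` U) (f \o a).
Proof.
move=> oU al; elim: k Z f => [//|k IH] Z f [df Cf].
apply: (@Ck_succ _ _ oU _ _ _ (fun x v => 'd f (a x) (l v))) => [x Ux|v].
  by apply: is_diff_comp; apply/differentiableP; exact: df.
exact: (IH _ _ (Cf (l v))).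
Qed.

(** The differential of [g \o f] applies ['d g (f x)] to a vector that moves
    with [x]. Expanding this vector in a basis writes it as a sum of products [l
    i ('d f x v) *: 'd g (f x) (e i)] in which the inner differential has a
    fixed argument, so that the induction hypothesis applies to each factor. *)
Lemma Ck_comp_basis V W Z n (e : 'I_n -> W) (l : 'I_n -> {linear W -> R^o})
    k (U : set V) (U' : set W) (f : V -> W) (g : W -> Z) :
  (forall i, continuous (l i)) -> (forall u, u = \sum_i l i u *: e i) ->
  open U -> (forall x, U x -> U' (f x)) ->
  times_differentiable_on k U f -> times_differentiable_on k U' g ->
  times_differentiable_on k U (g \o f).
Proof.
move=> cl le oU UU'; elim: k Z g => [//|k IH] Z g Cf [dg Cg].
have [df Cdf] := Cf.
apply: (@Ck_succ _ _ oU _ _ _ (fun x v => 'd g (f x) ('d f x v))) => [x Ux|v].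
  apply: is_diff_comp; first by apply/differentiableP; exact: df.
  by apply/differentiableP/dg/UU'.
apply: (@Ck_ext _ _ oU _ _
  (fun x => \sum_(i < n) l i ('d f x v) *: ('d g (f x) (e i)))).
  move=> x Ux; rewrite [in RHS](le ('d f x v)) linear_sum.
  by apply: eq_bigr => i _; rewrite linearZ.
apply: (Ck_sum oU) => i _; apply: (CkZ oU).
  exact: (Ck_lin oU (cl i) (Cdf v)).
exact: (IH _ _ (Ck_pred Cf) (Cg (e i))).
Qed.

Definition mx_entry m n (i : 'I_m) (j : 'I_n) : {linear 'M[R]_(m, n) -> R^o}.
Proof.
by exists (fun N : 'M[R]_(_, _) => N i j); do 2![eexists]; do ?[constructor];
     rewrite ?mxE// => ? *; rewrite ?mxE//; move=> ?; rewrite !mxE.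
Defined.

Lemma Ck_comp V n W k (U : set V) (U' : set 'rV[R]_n)
    (f : V -> 'rV[R]_n) (g : 'rV[R]_n -> W) :
  open U -> (forall x, U x -> U' (f x)) ->
  times_differentiable_on k U f -> times_differentiable_on k U' g ->
  times_differentiable_on k U (g \o f).
Proof.
apply: (@Ck_comp_basis _ _ _ _ (fun i => delta_mx 0 i) (mx_entry 0)).
  by move=> i; exact: coord_continuous.
exact: row_sum_delta.
Qed.

Lemma Ck_comp1 V W k (U : set V) (U' : set R^o) (f : V -> R^o) (g : R^o -> W) :
  open U -> (forall x, U x -> U' (f x)) ->
  times_differentiable_on k U f -> times_differentiable_on k U' g ->
  times_differentiable_on k U (g \o f).
Proof.
apply: (@Ck_comp_basis V R^o W 1 (fun=> 1 : R^o)
  (fun=> (idfun : {linear R^o -> R^o}))) => [i x|u].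
  exact: id.
by rewrite big_ord1 /= [RHS]mulr1.
Qed.

Lemma Ck_coord V k (U : set V) m n (f : V -> 'M[R]_(m, n)) i j : open U ->
  times_differentiable_on k U f ->
  times_differentiable_on k U (fun x => f x i j : R^o).
Proof.
move=> oU; apply: (@Ck_lin _ _ oU _ _ _ (mx_entry i j)).
exact: coord_continuous.
Qed.

End SmoothCalculus.
(** * Smooth functions of one variable *)

Section Bump.
Context {R : realType}.

Lemma is_derive_is_diff (f : R^o -> R^o) (t a : R) :
  is_derive t (1:R) (f : R -> R) a -> is_diff (t : R^o) f (fun v => v * a : R^o).
Proof.
move=> fa; split; first by apply/derivable1_diffP.
rewrite deriv1E; last by [].
by rewrite derive1E derive_val.
Qed.

Lemma Ck_deriv k (f df : R^o -> R^o) :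
  (forall t : R, is_derive t (1 : R) (f : R -> R) (df t)) ->
  times_differentiable_on k setT df -> times_differentiable_on k.+1 setT f.
Proof.
move=> fdf Cdf. refine (@Ck_succ R _ setT openT R^o k f (fun t v => v * df t) _ _).
  by move=> t _; exact: is_derive_is_diff.
by move=> v; exact: (CkM openT (Ck_cst openT k _) Cdf).
Qed.

Lemma Ck_sin_cos k : times_differentiable_on k setT (sin : R^o -> R^o) /\
  times_differentiable_on k setT (cos : R^o -> R^o).
Proof.
elim: k => [//|k [Cs Cc]]; split.
  by apply: Ck_deriv Cc => t; exact: is_derive_sin.
apply: (@Ck_deriv _ _ (fun t => - 1 * sin t)) => [t|].
  by rewrite mulN1r; exact: is_derive_cos.
exact: (CkM openT (Ck_cst openT k _) Cs).
Qed.

(** The powers of [t^-1] are included so that the family is closed under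
    derivation. *)
Definition exp_flat n (t : R^o) : R^o :=
  if 0 < t then t^-1 ^+ n * expR (- t^-1) else 0.

(** This is [expR s >= (s / k) ^ k] for [k = n + 2] and [s = h^-1]; the exponent
    is chosen so that a factor [h ^ 2] is left over, which gives a zero
    derivative at the origin. *)
Lemma exp_flat_bound n (h : R) : 0 <= exp_flat n h <= n.+2%:R ^+ n.+2 * h ^+ 2.
Proof.
rewrite /exp_flat; case: ifPn => h0; last by rewrite lexx mulr_ge0 ?sqr_ge0 ?exprn_ge0.
rewrite mulr_ge0 ?expR_ge0 ?exprn_ge0 ?invr_ge0 ?(ltW h0)//=.
have s0 : 0 < h^-1 by rewrite invr_gt0.
have m0 : (0 : R) < n.+2%:R by rewrite ltr0n.
have E : (h^-1 / n.+2%:R) ^+ n.+2 <= expR h^-1.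
  have -> : expR h^-1 = expR (h^-1 / n.+2%:R) ^+ n.+2.
    by rewrite -expRM_natl mulrC divfK// gt_eqF.
  rewrite lerXn2r ?nnegrE ?expR_ge0 ?divr_ge0 ?(ltW s0) ?(ltW m0)//.
  by apply: le_trans (expR_ge1Dx _); rewrite lerDr.
rewrite expRN ler_pdivrMr ?expR_gt0//.
apply: le_trans (ler_wpM2l _ E); last by rewrite mulr_ge0 ?exprn_ge0 ?ltW.
rewrite expr_div_n [h^-1 ^+ n.+2]exprS [h^-1 ^+ n.+1]exprS.
have M0 : n.+2%:R ^+ n.+2 != 0 :> R by rewrite expf_neq0 ?gt_eqF.
have h0' : h != 0 by rewrite gt_eqF.
move: (n.+2%:R ^+ n.+2) (h^-1 ^+ n) M0 => M H M0.
by rewrite le_eqVlt; apply/orP; left; apply/eqP; field; apply/andP.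
Qed.

(** At the origin the difference quotient of the [n]-th function is the
    [n.+1]-th one, which is continuous there by [exp_flat_bound]. *)
Lemma is_derive_exp_flat n (t : R) : is_derive t (1 : R) (exp_flat n : R -> R)
  (- n%:R * exp_flat n.+1 t + exp_flat n.+2 t).
Proof.
case: (ltgtP t 0) => [t0|t0|->].
- rewrite /exp_flat ltNge (ltW t0)/= mulr0 addr0.
  apply: (@near_eq_is_derive _ _ _ (cst 0)).
  near=> y; have y0 : y < 0 by near: y; exact: lt_nbhsl.
  by rewrite ltNge (ltW y0).
- rewrite [exp_flat n.+1 t]/exp_flat [exp_flat n.+2 t]/exp_flat t0.
  apply: (@near_eq_is_derive _ _ _ (fun t : R => t^-1 ^+ n * expR (- t^-1))).
    near=> y; have y0 : 0 < y by near: y; exact: lt_nbhsr.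
    by rewrite /exp_flat y0.
  have tn0 : t != 0 by rewrite gt_eqF.
  have dV : is_derive t (1 : R) (fun y : R => y^-1) (- t ^- 2).
    by apply: is_derive_eq (is_deriveV tn0 (is_derive_id t 1)) _; rewrite [_ *: _]mulr1.
  have dX : is_derive t (1 : R) (fun y : R => y^-1 ^+ n) (- n%:R * t^-1 ^+ n.+1).
    case: n => [|n]; first by rewrite oppr0 mul0r; exact: is_derive_cst.
    have := is_deriveX n.+1 dV; rewrite exprfctE.
    move=> /is_derive_eq; apply.
    by rewrite /GRing.scale /= -exprVn !exprS; ring.
  have dE : is_derive t (1 : R) (fun y : R => expR (- y^-1)) (expR (- t^-1) * t^-1 ^+ 2).
    apply: (@is_derive1_comp _ expR (fun y => - y^-1)).
    by apply: is_derive_eq (is_deriveN dV) _; rewrite opprK exprVn.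
  apply: is_derive_eq (is_deriveM dX dE) _.
  rewrite /GRing.scale /= !exprS; ring.
- apply/is_derive1_caratheodory; exists (exp_flat n.+1); split => [z||].
  + rewrite subr0 {2}/exp_flat ltxx subr0 /exp_flat; case: ifPn => z0; last by rewrite mul0r.
    by rewrite exprS; field; rewrite gt_eqF.
  + apply/cvgrPdist_le => e e0; near=> h.
    rewrite {1}/exp_flat ltxx sub0r normrN.
    have /andP[f0 /le_trans] := exp_flat_bound n.+1 h.
    rewrite ger0_norm//; apply.
    rewrite -ler_pdivlMl ?exprn_gt0 ?ltr0n// mulrC.
    have h1 : `|h| <= 1.
      near: h.
      exact: (@nbhs0_le R R^o 1 ltr01).
    apply: (@le_trans _ _ `|h|).
      by rewrite -real_normK ?num_real// expr2 ler_piMl.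
    near: h; apply: (@nbhs0_le R R^o).
    by rewrite divr_gt0 ?exprn_gt0 ?ltr0n.
  + by rewrite /exp_flat ltxx mulr0 addr0.
Unshelve. all: by end_near. Qed.

Lemma Ck_exp_flat k n : times_differentiable_on k setT (exp_flat n).
Proof.
elim: k n => [//|k IH] n; apply: Ck_deriv => [t|].
  exact: is_derive_exp_flat.
exact: (CkD openT (CkM openT (Ck_cst openT k _) (IH n.+1)) (IH n.+2)).
Qed.

End Bump.
(** * Mean value inequalities and primitives *)

Section Picard.
Context {R : realType}.

Lemma mean_value_ineq1 (f df : R -> R) (a b D : R) : a <= b ->
  (forall s, a <= s <= b -> is_derive s (1 : R) f (df s)) ->
  (forall s, a <= s <= b -> `|df s| <= D) -> `|f b - f a| <= D * (b - a).
Proof.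
move=> ab dfE dfD.
have [c cab ->] : exists2 c, c \in `[a, b]%R & f b - f a = df c * (b - a).
  apply: MVT_segment => // [x|].
    by rewrite in_itv/= => /andP[/ltW ax /ltW xb]; apply: dfE; rewrite ax.
  apply: derivable_within_continuous => x; rewrite in_itv /= => xab.
  by have [] := dfE _ xab.
rewrite normrM (ger0_norm (_ : 0 <= b - a)) ?subr_ge0// ler_wpM2r ?subr_ge0//.
exact: dfD.
Qed.

Lemma is_derive_scale (a t : R) : is_derive t (1 : R) (fun s => a * s) a.
Proof.
by apply: is_derive_eq (is_deriveZ _ (is_derive_id _ _)) _; rewrite [_ *: _]mulr1.
Qed.

Section Row.
Variable m : nat.
Implicit Types u : 'rV[R]_m.

Lemma row_norm_le u D : 0 <= D -> (forall i, `|u 0 i| <= D) -> `|u| <= D.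
Proof.
move=> D0 uD; rewrite [leLHS]/Num.Def.normr/= mx_normrE.
by apply: bigmax_le => // -[i j] _; rewrite /= ord1.
Qed.

Lemma row_norm_ge u i : `|u 0 i| <= `|u|.
Proof.
rewrite [leRHS]/Num.Def.normr/= mx_normrE.
exact: (le_bigmax _ (fun ij => `|u ij.1 ij.2|) (0, i)).
Qed.

Lemma is_derive_rowP (F : R -> 'rV[R]_m) (t : R) v :
  is_derive t (1 : R) F v <-> forall i, is_derive t (1 : R) (fun s => F s 0 i) (v 0 i).
Proof.
split=> [[dF <-] i|dF].
  split; first by have /derivable_mxP := dF; exact.
  by rewrite derive_mx// mxE.
have DF : derivable F t (1 : R).
  by apply/derivable_mxP => i j; rewrite ord1; have [] := dF j.
split; first exact: DF.
apply/rowP => i; rewrite derive_mx// mxE.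
by have [_ ->] := dF i.
Qed.

Lemma is_derive_line x w (t : R) :
  is_derive t (1 : R) (fun s : R => x + s *: w : 'rV[R]_m) w.
Proof.
rewrite -[w in is_derive _ _ _ w]add0r; apply: is_deriveD.
apply/is_derive_rowP => i.
have -> : (fun s : R => (s *: w) 0 i) = (fun s => w 0 i * s).
  by apply/funext => s; rewrite mxE mulrC.
exact: is_derive_scale.
Qed.

Lemma mean_value_ineq (f df : R -> 'rV[R]_m) (a b D : R) : a <= b -> 0 <= D ->
  (forall s, a <= s <= b -> is_derive s (1 : R) f (df s)) ->
  (forall s, a <= s <= b -> `|df s| <= D) -> `|f b - f a| <= D * (b - a).
Proof.
move=> ab D0 dfE dfD; apply: row_norm_le; first by rewrite mulr_ge0 ?subr_ge0.
move=> i; rewrite !mxE.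
apply: (@mean_value_ineq1 (fun s => f s 0 i) (fun s => df s 0 i)) => // s sab.
  by have /is_derive_rowP := dfE _ sab; exact.
exact: le_trans (row_norm_ge _ _) (dfD _ sab).
Qed.

(** Both signs of [t] are needed later, because integral curves are followed
    forwards and backwards. *)
Lemma mean_value_ineq0 (f df : R -> 'rV[R]_m) (t B D : R) : 0 <= D -> `|t| < B ->
  (forall s, `|s| < B -> is_derive s (1 : R) f (df s)) ->
  (forall s, `|s| <= `|t| -> `|df s| <= D) -> `|f t - f 0| <= D * `|t|.
Proof.
move=> D0 tB dfE dfD; have [t0|t0] := leP 0 t.
  rewrite -[`|t|]subr0 [`|t|]ger0_norm//; apply: (mean_value_ineq (df := df)) => // s /andP[s0 st].
    by apply: dfE; apply: le_lt_trans tB; rewrite !ger0_norm.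
  by apply: dfD; rewrite !ger0_norm.
rewrite distrC [`|t|]ltr0_norm// -[- t]sub0r; apply: (mean_value_ineq (df := df)) => //; first exact: ltW.
  move=> s /andP[ts s0].
    by apply: dfE; apply: le_lt_trans tB; rewrite ler0_norm// ltr0_norm// lerN2.
move=> s /andP[ts s0].
by apply: dfD; rewrite ler0_norm// ltr0_norm// lerN2.
Qed.

(** Integrating from [- B] instead of [0] makes the fundamental theorem apply at
    every point of the open interval, the origin included; the constant is
    corrected afterwards. *)
Lemma primitive1 (f : R -> R) (B : R) : continuous f ->
  exists F : R -> R, F 0 = 0 /\
    forall t, `|t| < B -> is_derive t (1 : R) F (f t).
Proof.
move=> cf.
have intf : lebesgue_measure.-integrable `[- B, B] (EFin \o f).
  apply: continuous_compact_integrable; first exact: segment_compact.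
  exact: continuous_subspaceT.
pose G x := (\int[lebesgue_measure]_(t in [set` `[- B, x]]) (f t))%R.
exists (fun x => G x - G 0); split; first by rewrite subrr.
move=> t; rewrite ltr_norml => /andP[Bt tB].
have [dG Gf] := continuous_FTC1_closed tB intf Bt (cf t).
have dG' : is_derive t (1 : R) G (f t).
  by apply: DeriveDef; [exact: dG|rewrite -derive1E; exact: Gf].
by apply: is_derive_eq (is_deriveB dG' (is_derive_cst (G 0) t 1)) _; rewrite subr0.
Qed.

Lemma primitive (f : R -> 'rV[R]_m) (B : R) : continuous f ->
  exists F : R -> 'rV[R]_m, F 0 = 0 /\
    forall t, `|t| < B -> is_derive t (1 : R) F (f t).
Proof.
move=> cf.
have cfi i : continuous (fun s => f s 0 i).
  by move=> s; apply: (@continuous_comp _ _ _ f (fun u : 'rV[R]_m => u 0 i)) => [|/=]; [exact: cf|exact: coord_continuous].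
have [F FP] := choice (fun i => primitive1 B (cfi i)).
exists (fun s => \row_i F i s); split.
  by apply/rowP => i; rewrite !mxE; have [] := FP i.
move=> t tB; apply/is_derive_rowP => i.
have -> : (fun s : R => (\row_i F i s) 0 i) = F i by apply/funext => s; rewrite mxE.
by have [_ E] := FP i; exact: E.
Qed.

End Row.
End Picard.
(** * Integral curves of bounded Lipschitz fields *)

Section PicardLindelof.
Context {R : realType} {m : nat}.
Local Notation E := 'rV[R]_m.

Definition clamp (T t : R) : R := Num.max (- T) (Num.min T t).

Lemma clamp_lip T t s : `|clamp T t - clamp T s| <= `|t - s|.
Proof.
rewrite /clamp; move: (- T) => T'.
have norm_le (a c d : R) : `|a - c| <= `|d| <-> - `|d| <= a - c <= `|d|.
  by rewrite ler_norml.
have h (b a c : R) : `|Num.min b a - Num.min b c| <= `|a - c|.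
  rewrite !minEle; apply/norm_le.
  by have [?|?] := leP 0 (a - c); [rewrite ger0_norm//|rewrite ltr0_norm//];
    case: (leP b a) => ?; case: (leP b c) => ?; apply/andP; split; lra.
have h' (b a c : R) : `|Num.max b a - Num.max b c| <= `|a - c|.
  rewrite !maxEle; apply/norm_le.
  by have [?|?] := leP 0 (a - c); [rewrite ger0_norm//|rewrite ltr0_norm//];
    case: (leP b a) => ?; case: (leP b c) => ?; apply/andP; split; lra.
exact: le_trans (h' _ _ _) (h _ _ _).
Qed.

Lemma clamp_le T t : 0 <= T -> `|clamp T t| <= T.
Proof. by move=> T0; rewrite ler_norml /clamp le_max lexx/= ge_max ge_min lexx andbT; lra. Qed.

Lemma clamp_id T t : `|t| <= T -> clamp T t = t.
Proof. by rewrite ler_norml => /andP[Tt tT]; rewrite /clamp (min_idPr tT) (max_idPr Tt). Qed.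

Lemma lipschitz_continuous (V W : normedModType R) (f : V -> W) (L : R) :
  (forall x y, `|f x - f y| <= L * `|x - y|) -> continuous f.
Proof.
move=> fL x; apply/cvgrPdist_le => e e0.
near=> y; apply: (le_trans (fL x y)).
have L1 : 0 < `|L| + 1 by rewrite ltr_wpDl.
apply: (@le_trans _ _ ((`|L| + 1) * `|x - y|)).
  by rewrite ler_wpM2r// (le_trans (ler_norm L))// lerDl.
rewrite -ler_pdivlMl//; near: y.
by apply: cvgr_dist_le => //; rewrite mulr_gt0 ?invr_gt0.
Unshelve. all: by end_near. Qed.

(** How the equalities between limits of geometrically converging sequences are
    obtained below. *)
Lemma le_geometric (x C : R) : (forall n, x <= C / 2 ^+ n) -> x <= 0.
Proof.
move=> xC; rewrite leNgt; apply/negP => x0.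
have Cx : x <= `|C| by apply: le_trans (xC 0) _; rewrite expr0 divr1 ler_norm.
pose n := (Num.truncn (`|C| / x)).+1.
have := xC n; apply/negP; rewrite -ltNge.
have n2 : `|C| / x < 2 ^+ n.
  apply: lt_le_trans (truncnS_gt _) _.
  by rewrite -natrX ler_nat ltnW// ltn_expl.
rewrite ltr_pdivrMr ?exprn_gt0// mulrC -ltr_pdivrMr//.
by apply: le_lt_trans n2; rewrite ler_wpM2r ?invr_ge0 ?(ltW x0)// ler_norm.
Qed.

(** The Picard iterates are precomposed with the clamping of time to [[-T, T]].
    They are then defined and [A]-Lipschitz on the whole line, consecutive ones
    get closer by a factor [T L <= 1/2] uniformly, and their limit is again
    [A]-Lipschitz, hence continuous, so that the field along it has a primitive.
    This primitive agrees with the limit on [[-T, T]]. *)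
Theorem picard_lindelof (X : E -> E) (L A T : R) (y0 : E) :
  0 < T -> 0 <= L -> T * L <= 2^-1 -> 0 <= A ->
  (forall x, `|X x| <= A) -> (forall x y, `|X x - X y| <= L * `|x - y|) ->
  exists gam : R -> E, gam 0 = y0 /\
    forall t, `|t| < T -> is_derive t (1 : R) gam (X (gam t)).
Proof.
move=> T0 L0 TL A0 XA XL.
have XC : continuous X := lipschitz_continuous XL.
(* [P f] is the primitive of [X \o f] vanishing at 0; the margin [T + 1] makes
   it differentiable at both ends of the interval. *)
have [P PE] : exists P : (R -> E) -> (R -> E), forall f, continuous f ->
    P f 0 = 0 /\ forall t, `|t| < T + 1 -> is_derive t (1 : R) (P f) (X (f t)).
  suff /choice[P PE] : forall f : R -> E, exists F : R -> E, continuous f ->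
      F 0 = 0 /\ forall t, `|t| < T + 1 -> is_derive t (1 : R) F (X (f t)).
    by exists P.
  move=> f; have [cf|ncf] := pselect (continuous f); last by exists (cst 0).
  have cXf : continuous (X \o f) by move=> s; apply: continuous_comp; [exact: cf|exact: XC].
  by have [F FE] := primitive (T + 1) cXf; exists F.
pose step (f : R -> E) (t : R) : E := y0 + P f (clamp T t).
pose z n : R -> E := iter n step (cst y0).
have cT t : `|clamp T t| < T + 1 by rewrite (le_lt_trans (clamp_le t (ltW T0)))// ltrDl.
have stepL f : continuous f -> forall t s, `|step f t - step f s| <= A * `|t - s|.
  move=> cf t s; rewrite /step opprD addrACA subrr add0r.
  have [_ dP] := PE f cf.
  apply: (@le_trans _ _ (A * `|clamp T t - clamp T s|)); last first.
    by rewrite ler_wpM2l ?clamp_lip.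
  wlog ts : t s / clamp T s <= clamp T t.
    by move=> H; have [/H//|/ltW/H] := leP (clamp T s) (clamp T t); rewrite distrC [`|clamp T s - _|]distrC.
  rewrite [X in _ * X]ger0_norm ?subr_ge0//.
  apply: (mean_value_ineq (df := X \o f)) => //= r /andP[sr rt]; apply: dP.
  have := cT t; have := cT s; rewrite !ltr_norml => /andP[s1 _] /andP[_ t1].
  by rewrite (lt_le_trans s1)//= (le_lt_trans rt).
have zL n t s : `|z n t - z n s| <= A * `|t - s|.
  elim: n t s => [|n IH] t s; first by rewrite subrr normr0 mulr_ge0.
  by apply: stepL; exact: lipschitz_continuous IH.
have zC n : continuous (z n) := lipschitz_continuous (zL n).
have stepD f g D : continuous f -> continuous g -> 0 <= D ->
    (forall t, `|f t - g t| <= D) -> forall t, `|step f t - step g t| <= D / 2.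
  move=> cf cg D0 fg t; rewrite /step opprD addrACA subrr add0r.
  have [P0 dP] := PE f cf; have [Q0 dQ] := PE g cg.
  have XD s : `|X (f s) - X (g s)| <= L * D.
    by apply: le_trans (XL _ _) _; rewrite ler_wpM2l.
  have Fd s : `|s| < T + 1 -> is_derive s (1 : R) (P f - P g) (X (f s) - X (g s)).
    by move=> sT; apply: is_deriveB; [exact: dP|exact: dQ].
  have := mean_value_ineq0 (mulr_ge0 L0 D0) (cT t) Fd (fun s _ => XD s).
  rewrite !fctE P0 Q0 subrr subr0 => /le_trans; apply.
  rewrite mulrAC [leRHS]mulrC ler_wpM2r//; apply: le_trans TL.
  by rewrite mulrC ler_wpM2r// clamp_le// ltW.
have zD n t : `|z n.+1 t - z n t| <= (A * T) / 2 ^+ n.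
  elim: n t => [|n IH] t.
    rewrite expr0 divr1 /z /= /step addrC addKr.
    have [P0 dP] := PE (cst y0) (zC 0%N).
    rewrite -[P _ _]subr0 -P0.
    apply: (le_trans (mean_value_ineq0 A0 (cT t) dP (fun s _ => XA _))).
    by rewrite ler_wpM2l// clamp_le// ltW.
  rewrite exprS invfM [2^-1 * _]mulrC mulrA.
  apply: (stepD _ _ _ (zC n.+1) (zC n)) => //.
  by rewrite !mulr_ge0 ?invr_ge0 ?exprn_ge0 ?(ltW T0).
have zD2 n k t : `|z (n + k)%N t - z n t| <= (2 * (A * T)) / 2 ^+ n.
  suff : `|z (n + k)%N t - z n t| <= (2 * (A * T)) * (2 ^- n - 2 ^- (n + k)).
    move=> /le_trans; apply; rewrite ler_wpM2l ?mulr_ge0 ?(ltW T0)//.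
    by rewrite gerBl invr_ge0 exprn_ge0.
  elim: k => [|k IH]; first by rewrite addn0 !subrr normr0 mulr0.
  rewrite addnS -(subrKA (z (n + k)%N t)).
  apply: (le_trans (ler_normD _ _)).
  apply: (le_trans (lerD (zD _ _) IH)).
  rewrite exprS invfM; move: (2 ^- n) (2 ^- (n + k)) => a b; lra.
have zcauchy t : cvgn (fun n => z n t).
  apply/cauchy_cvgP/cauchy_exP => e e0.
  have [N HN] : exists N, (2 * (A * T)) / 2 ^+ N < e.
    apply: contrapT => /forallNP H; have : e <= 0.
      by apply: (@le_geometric _ (2 * (A * T))) => n; rewrite leNgt; apply/negP/H.
    by rewrite leNgt e0.
  exists (z N t); exists N => //= n /= Nn; rewrite -ball_normE /= distrC.
  by rewrite -(subnKC Nn); exact: le_lt_trans (zD2 _ _ _) HN.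
have [w wE] : exists w : R -> E, forall n t, `|w t - z n t| <= (2 * (A * T)) / 2 ^+ n.
  exists (fun t => limn (fun n => z n t)) => n t.
  apply/ler_addgt0Pr => e e0.
  have /cvgrPdist_le/(_ e e0)[k _ kE] := zcauchy t.
  have := kE (n + k)%N (leq_addl _ _) => /= H.
  rewrite -(subrKA (z (n + k)%N t)) addrC.
  by apply: (le_trans (ler_normD _ _)); apply: lerD.
have wL t s : `|w t - w s| <= A * `|t - s|.
  rewrite -subr_le0; apply: (@le_geometric _ (2 * (2 * (A * T)))) => n.
  rewrite lerBlDr; have H1 := wE n t; have H2 := wE n s; have H3 := zL n t s.
  have -> : w t - w s = (w t - z n t) + (z n t - z n s) + (z n s - w s).
    by rewrite !addrA subrK subrK.
  apply: (le_trans (ler_normD _ _)).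
  rewrite distrC in H2.
  have := lerD (le_trans (ler_normD (w t - z n t) (z n t - z n s)) (lerD H1 H3)) H2.
  by move=> /le_trans; apply; rewrite -!mulrA; lra.
have wC : continuous w := lipschitz_continuous wL.
have wfix t : w t = step w t.
  apply/eqP; rewrite -subr_eq0 -normr_le0.
  apply: (@le_geometric _ (2 * (2 * (A * T)))) => n.
  have D0 : 0 <= 2 * (A * T) / 2 ^+ n.
    by rewrite !mulr_ge0 ?invr_ge0 ?exprn_ge0 ?(ltW T0).
  have := stepD _ _ _ (zC n) wC D0 (fun s => _).
  move=> /(_ _ t) H.
  have {}H : `|z n.+1 t - step w t| <= 2 * (A * T) / 2 ^+ n / 2.
    by apply: H => s; rewrite distrC.
  rewrite -(subrKA (z n.+1 t)).
  apply: (le_trans (ler_normD _ _)).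
  apply: (le_trans (lerD (wE _ _) H)).
  rewrite exprS invfM; move: (2 ^- n) D0 => a D0; lra.
have [P0 dP] := PE w wC.
exists w; split.
  by rewrite wfix /step clamp_id ?normr0 ?ltW// P0 addr0.
move=> t tT.
have dP' : is_derive t (1 : R) (fun s => y0 + P w s) (X (w t)).
  rewrite -[X (w t)]add0r; apply: is_deriveD.
  by apply: dP; apply: lt_trans tT _; rewrite ltrDl.
apply: near_eq_is_derive dP'.
near=> s; rewrite [RHS]wfix /step clamp_id// ltW//; near: s.
by apply: (cvgr_lt `|t|) => //; exact: (@norm_continuous _ R^o).
Unshelve. all: by end_near. Qed.

End PicardLindelof.
(** * Integral curves of smooth fields near a point *)

Section LocalFlow.
Context {R : realType}.

Lemma is_derive_diff_comp (V W : normedModType R) (gam : R -> V) (f : V -> W) (t : R) v :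
  is_derive t (1 : R) gam v -> differentiable f (gam t) ->
  is_derive t (1 : R) (f \o gam) ('d f (gam t) v).
Proof.
move=> [dg <-] df; have dg' : differentiable gam t by apply/derivable1_diffP.
have dc := differentiable_comp dg' df.
split; first by apply/derivable1_diffP.
by rewrite !deriveE// diff_comp.
Qed.

Context {m : nat}.
Local Notation E := 'rV[R]_m.
Implicit Types (x y : E).

(** The norm on row vectors is the maximum norm, so closed balls are cubes; this
    is what makes the coordinatewise retraction [cube_clamp] work. *)
Definition cube x0 (r : R) : set E := [set x | `|x - x0| <= r].

Lemma cube_compact x0 r : compact (cube x0 r).
Proof.
apply: bounded_closed_compact.
  exists (`|x0| + r); split; first exact: num_real.
  move=> M rM x xr; apply: le_trans (ltW rM).
  rewrite -[x](subrK x0); apply: (le_trans (ler_normD _ _)).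
  by rewrite [leRHS]addrC lerD2r.
rewrite (_ : cube x0 r = (fun x => `|x - x0|) @^-1` [set s | s <= r])//.
apply: closed_comp; last exact: closed_le.
move=> x _; apply: (@continuous_comp _ _ _ (fun x => x - x0) (fun x => `|x|)).
  by apply: (@cvgB _ _ _ (nbhs x) _ id (cst x0)); [exact: cvg_id|exact: cvg_cst].
exact: norm_continuous.
Qed.

Lemma cube_convex x0 r x y (s : R) : cube x0 r x -> cube x0 r y -> 0 <= s <= 1 ->
  cube x0 r (y + s *: (x - y)).
Proof.
rewrite /cube/= => xr yr /andP[s0 s1].
have -> : y + s *: (x - y) - x0 = (1 - s) *: (y - x0) + s *: (x - x0).
  by apply/rowP => i; rewrite !mxE; ring.
apply: (le_trans (ler_normD _ _)); rewrite !normrZ (ger0_norm s0) ger0_norm ?subr_ge0//.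
have -> : r = (1 - s) * r + s * r by ring.
by rewrite lerD// ler_wpM2l// subr_ge0.
Qed.

(** The partial derivatives are continuous, hence bounded on the compact cube,
    and the segment between two of its points stays inside it. *)
Lemma smooth_lipschitz (U : set E) (f : E -> R^o) x0 r :
  times_differentiable_on 2 U f -> cube x0 r `<=` U ->
  exists L : R, 0 <= L /\
    forall x y, cube x0 r x -> cube x0 r y -> `|f x - f y| <= L * `|x - y|.
Proof.
move=> [df Cf] rU.
have Cb (i : 'I_m) : exists C : R, 0 <= C /\
    forall x, cube x0 r x -> `|'d f x (delta_mx 0 i)| <= C.
  have : compact ((fun x => 'd f x (delta_mx 0 i) : R^o) @` cube x0 r).
    apply: continuous_compact; last exact: cube_compact.
    apply/continuous_in_subspaceT => x; rewrite inE => xr.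
    apply: differentiable_continuous.
    by have [+ _] := Cf (delta_mx 0 i); apply; exact: rU.
  move=> /compact_bounded[M [Mr MP]].
  exists (`|M| + 1); split; first by rewrite addr_ge0.
  move=> x xr; apply: (MP (`|M| + 1)); last by exists x.
  by rewrite (le_lt_trans (ler_norm M))// ltrDl.
have /choice[C CP] := Cb.
have S0 : 0 <= \sum_i C i by apply: sumr_ge0 => i _; have [] := CP i.
exists (\sum_i C i); split => // x y xr yr.
have dB z v : cube x0 r z -> `|'d f z v| <= (\sum_i C i) * `|v|.
  move=> zr; rewrite [v in 'd f z v]row_sum_delta linear_sum mulr_suml.
  apply: (le_trans (ler_norm_sum _ _ _)); apply: ler_sum => i _.
  rewrite linearZ/= normrM mulrC; apply: ler_pM => //; last exact: row_norm_ge.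
  by have [_] := CP i; apply.
pose g (s : R) := y + s *: (x - y).
have dg s : is_derive s (1 : R) g (x - y) by exact: is_derive_line.
have gr s : 0 <= s <= 1 -> cube x0 r (g s) by exact: cube_convex.
have := @mean_value_ineq1 R (f \o g) (fun s => 'd f (g s) (x - y)) 0 1 ((\sum_i C i) * `|x - y|) ler01.
have e1 : g 1 = x by rewrite /g scale1r addrC subrK.
have e0 : g 0 = y by rewrite /g scale0r addr0.
rewrite /= e1 e0 subr0 mulr1; apply => s s01.
  by apply: is_derive_diff_comp; apply: df; apply: rU; exact: gr.
by apply: dB; exact: gr.
Qed.

Definition cube_clamp x0 (r : R) x : E := \row_i (x0 0 i + clamp r (x 0 i - x0 0 i)).

Lemma cube_clamp_in x0 r x : 0 <= r -> cube x0 r (cube_clamp x0 r x).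
Proof.
move=> r0; apply: row_norm_le => // i; rewrite !mxE addrC addKr.
exact: clamp_le.
Qed.

Lemma cube_clamp_id x0 r x : cube x0 r x -> cube_clamp x0 r x = x.
Proof.
move=> xr; apply/rowP => i; rewrite mxE clamp_id; first by rewrite addrCA subrr addr0.
apply: le_trans xr; by have := row_norm_ge (x - x0) i; rewrite !mxE.
Qed.

Lemma cube_clamp_lip x0 r x y : `|cube_clamp x0 r x - cube_clamp x0 r y| <= `|x - y|.
Proof.
apply: row_norm_le => // i; rewrite !mxE opprD addrACA subrr add0r.
apply: (le_trans (clamp_lip _ _ _)); rewrite opprB addrA subrK.
by have := row_norm_ge (x - y) i; rewrite !mxE.
Qed.

(** The field is only controlled on a cube. Precomposed with the 1-Lipschitz
    retraction onto the cube it becomes bounded and Lipschitz everywhere, and a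
    curve starting in the cube of half the size cannot leave the large one
    before time [r / (2 A)], where [A] bounds the speed. One time [T] serves for
    all the starting points. *)
Theorem local_flow (U : set E) (X : E -> E) x0 (r : R) : 0 < r ->
  (forall i, times_differentiable_on 2 U (fun x => X x 0 i : R^o)) ->
  cube x0 r `<=` U ->
  exists T : R, 0 < T /\ forall y, cube x0 (r / 2) y ->
    exists gam : R -> E, gam 0 = y /\ forall t, `|t| < T ->
      cube x0 r (gam t) /\ is_derive t (1 : R) gam (X (gam t)).
Proof.
move=> r0 CX rU.
have /choice[L LP] := fun i => smooth_lipschitz (CX i) rU.
pose K := \sum_i L i.
have K0 : 0 <= K by apply: sumr_ge0 => i _; have [] := LP i.
have XL x y : cube x0 r x -> cube x0 r y -> `|X x - X y| <= K * `|x - y|.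
  move=> xr yr; apply: row_norm_le => [|i]; first by rewrite mulr_ge0.
  rewrite !mxE; have [Li0 /(_ _ _ xr yr)/le_trans] := LP i; apply.
  rewrite ler_wpM2r// /K (bigD1 i)//= lerDl.
  by apply: sumr_ge0 => j _; have [] := LP j.
have x0r : cube x0 r x0 by rewrite /cube/= subrr normr0 ltW.
pose A := `|X x0| + K * r.
have A0 : 0 <= A by rewrite addr_ge0// mulr_ge0// ltW.
have XA x : cube x0 r x -> `|X x| <= A.
  move=> xr; rewrite -[X x](subrK (X x0)); apply: (le_trans (ler_normD _ _)).
  by rewrite /A [leRHS]addrC lerD2r; apply: (le_trans (XL _ _ xr x0r)); rewrite ler_wpM2l.
pose T := Num.min (2 * (K + 1))^-1 (r / (2 * (A + 1))).
have T0 : 0 < T.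
  by rewrite lt_min invr_gt0 mulr_gt0 ?divr_gt0 ?mulr_gt0 ?ltr_wpDl.
have TK : T * K <= 2^-1.
  apply: (@le_trans _ _ ((2 * (K + 1))^-1 * K)).
    by rewrite ler_wpM2r// ge_min lexx.
  by rewrite invfM -mulrA ger_pMr// mulrC ler_pdivrMr ?ltr_wpDl// mul1r lerDl.
have TA : A * T <= r / 2.
  apply: (@le_trans _ _ (A * (r / (2 * (A + 1))))).
    by rewrite ler_wpM2l// ge_min lexx orbT.
  rewrite invfM !mulrA [A * r]mulrC -!mulrA ler_wpM2l ?(ltW r0)//.
  by rewrite mulrCA ger_pMr// ler_pdivrMr ?ltr_wpDl// mul1r lerDl.
exists T; split => // y yr.
have rr x : cube x0 r (cube_clamp x0 r x) by apply: cube_clamp_in; exact: ltW.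
have [|x y' |gam [g0 dg]] := @picard_lindelof _ _ (X \o cube_clamp x0 r) K A T y T0 K0 TK A0.
- by move=> x; exact: XA.
- apply: (le_trans (XL _ _ _ _)) => //.
  by rewrite ler_wpM2l// cube_clamp_lip.
exists gam; split => // t tT.
have gr : cube x0 r (gam t).
  rewrite /cube/= -(subrKA (gam 0)) g0 [r]splitr; apply: (le_trans (ler_normD _ _)).
  apply: lerD => //; apply: le_trans TA; rewrite -{1}g0.
  apply: (le_trans (mean_value_ineq0 A0 tT dg (fun s _ => XA _ _))) => //.
  by rewrite ler_wpM2l// ltW.
split => //; have := dg t tT; by rewrite /= cube_clamp_id.
Qed.

End LocalFlow.
(** * Hamiltonian functions and fields in a chart *)

Section LocalHamiltonian.
Context {R : realType} {m : nat}.
Local Notation E := 'rV[R]_m.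
Implicit Types (x y u v : E).

Lemma row_linear_continuous (W : normedModType R) (l : {linear E -> W}) :
  continuous l.
Proof.
apply: (@lipschitz_continuous _ _ _ _ (\sum_i `|l (delta_mx 0 i)|)) => x y.
rewrite -linearB [X in l X]row_sum_delta linear_sum mulr_suml.
apply: (le_trans (ler_norm_sum _ _ _)); apply: ler_sum => i _.
by rewrite linearZ normrZ mulrC ler_wpM2l// row_norm_ge.
Qed.

Lemma is_diff_shift x0 x : is_diff x (fun y => y - x0) id.
Proof.
by apply: is_diff_eq (is_diffB (is_diff_id x) (is_diff_cst x0 x)) _; rewrite subr0.
Qed.

Lemma Ck_id k : times_differentiable_on k setT (id : E -> E).
Proof.
case: k => [//|k]; apply: (@Ck_succ R E setT openT E k id (fun _ v => v)).
by move=> v; exact: (Ck_cst openT k v).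
Qed.

Lemma Ck_shift k x0 : times_differentiable_on k setT (fun x => x - x0).
Proof. exact: (CkD openT (Ck_id k) (Ck_cst openT k (- x0))). Qed.

Definition bump x0 (r : R) x : R^o :=
  \prod_i (exp_flat 0 (r - (x - x0) 0 i) * exp_flat 0 (r + (x - x0) 0 i)).

Lemma Ck_bump k x0 r : times_differentiable_on k setT (bump x0 r).
Proof.
apply: (Ck_prod openT) => i _.
have Ci : times_differentiable_on k setT (fun x => (x - x0) 0 i : R^o).
  by apply: (Ck_coord 0 i openT); exact: Ck_shift.
apply: (CkM openT).
  apply: (Ck_comp1 openT (U' := setT) _ _ (Ck_exp_flat k 0)) => //.
  apply: (@CkD _ _ _ openT _ _ (fun=> r : R^o)); first exact: (Ck_cst openT k (r : R^o)).
  apply: (@Ck_ext _ _ _ openT _ _ (fun x => (-1 : R^o) * (x - x0) 0 i)).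
    by move=> x _; rewrite mulN1r.
  exact: (CkM openT (Ck_cst openT k _) Ci).
apply: (Ck_comp1 openT (U' := setT) _ _ (Ck_exp_flat k 0)) => //.
exact: (CkD openT (Ck_cst openT k (r : R^o)) Ci).
Qed.

Lemma exp_flat0_gt0 (t : R) : 0 < t -> 0 < exp_flat 0 t.
Proof. by move=> t0; rewrite /exp_flat t0 expr0 mul1r expR_gt0. Qed.

Lemma bump_gt0 x0 r : 0 < r -> 0 < bump x0 r x0.
Proof.
move=> r0; apply: prodr_gt0 => i _.
by rewrite subrr mxE subr0 addr0 mulr_gt0 ?exp_flat0_gt0.
Qed.

Lemma bump_cube x0 r x : 0 <= r -> ~ cube x0 r x -> bump x0 r x = 0.
Proof.
move=> r0 xr; apply: contrapT => /eqP; rewrite prodf_seq_neq0 => /allP bx; apply: xr.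
apply: row_norm_le => // i; have := bx i (mem_index_enum _).
rewrite /= mulf_eq0 negb_or /exp_flat => /andP[].
case: ifPn => [h1 _|_]; last by rewrite eqxx.
case: ifPn => [h2 _|_]; last by rewrite eqxx.
by rewrite ler_norml; apply/andP; split; lra.
Qed.

(** The function is the form [al], centred at [x0], times a bump. Since [al]
    vanishes at the centre, the derivative of the bump does not contribute to
    the differential there. *)
Lemma bump_hamiltonian (al : {linear E -> R^o}) x0 (r : R) : 0 < r ->
  exists (h : E -> R^o) (b : R), [/\ 0 < b, smooth_on setT h,
    (forall x, ~ cube x0 r x -> h x = 0),
    (forall x, al (x - x0) = 0 -> h x = 0) &
    (forall v, 'd h x0 v = b * al v)].
Proof.
move=> r0; exists (fun x => bump x0 r x * al (x - x0)), (bump x0 r x0); split.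
- exact: bump_gt0.
- move=> k; apply: (CkM openT); first exact: Ck_bump.
  by apply: (@Ck_lin _ _ _ openT _ _ _ al); [exact: row_linear_continuous|exact: Ck_shift].
- by move=> x xr; rewrite bump_cube ?mul0r// ltW.
- by move=> x ->; rewrite mulr0.
- move=> v.
  have [db _] := Ck_bump 1 x0 r.
  have dB := differentiableP (db x0 I).
  have da : is_diff x0 (al \o (fun y => y - x0)) al.
    apply: is_diff_eq.
      apply: (is_diff_comp (is_diff_shift x0 x0)).
      have ca : continuous al by exact: row_linear_continuous.
      by split; [exact: linear_differentiable|exact: diff_lin].
    by [].
  have [_ ->] := is_diffM dB da.
  by rewrite !fctE/= subrr linear0 scale0r addr0.
Qed.

(** Cramer's rule: the determinant and the cofactors are polynomial in the
    entries. *)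
Lemma Ck_invmx k (U : set E) n (A : E -> 'M[R]_n) i j : open U ->
  (forall i j, times_differentiable_on k U (fun x => A x i j : R^o)) ->
  (forall x, U x -> A x \in unitmx) ->
  times_differentiable_on k U (fun x => invmx (A x) i j : R^o).
Proof.
move=> oU CA uA.
apply: (@Ck_ext _ _ _ oU _ _ (fun x => (\det (A x))^-1 * cofactor (A x) j i : R^o)).
  by move=> x Ux; rewrite /invmx uA// !mxE.
apply: (CkM oU).
  apply: (CkV oU); last exact: (Ck_det oU).
  by move=> x /uA; rewrite unitmxE unitfE.
apply: (CkM oU); first exact: (Ck_cst oU k ((-1) ^+ (j + i) : R^o)).
apply: (Ck_det oU) => a b.
apply: Ck_ext (CA (lift j a) (lift i b)) => // x _.
by rewrite !mxE.
Qed.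

(** In coordinates [om x u v = u A(x) v^T], and nondegeneracy makes [A(x)]
    invertible, so the field is [A(x)^-1] applied to the gradient. *)
Lemma smooth_hamiltonian_field (U : set E) (om : E -> E -> E -> R) (h : E -> R^o) :
  open U ->
  (forall x, U x -> forall a u v w, om x (a *: u + v) w = a * om x u w + om x v w /\
     om x w (a *: u + v) = a * om x w u + om x w v) ->
  (forall u v, smooth_on U (fun x => om x u v : R^o)) ->
  (forall x, U x -> forall u, (forall v, om x u v = 0) -> u = 0) ->
  smooth_on U h ->
  exists X : E -> E, (forall i, smooth_on U (fun x => X x 0 i : R^o)) /\
    forall x, U x -> forall v, om x v (X x) = 'd h x v.
Proof.
move=> oU omL omC omN hC.
pose A x : 'M[R]_m := \matrix_(i, j) om x (delta_mx 0 i) (delta_mx 0 j).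
have omA x u v : U x -> om x u v = (u *m A x *m v^T) 0 0.
  move=> Ux.
  pose l1 (w u : E) : R^o := om x u w; pose l2 (w u : E) : R^o := om x w u.
  have l1L w : linear (l1 w) by move=> a u' v'; have [] := omL x Ux a u' v' w.
  have l2L w : linear (l2 w) by move=> a u' v'; have [] := omL x Ux a u' v' w.
  pose L1 w : {linear E -> R^o} := HB.pack (l1 w) (GRing.isLinear.Build _ _ _ _ _ (l1L w)).
  pose L2 w : {linear E -> R^o} := HB.pack (l2 w) (GRing.isLinear.Build _ _ _ _ _ (l2L w)).
  rewrite -mulmxA mxE -[om x u v]/(L1 v u) [in LHS](row_sum_delta u) linear_sum.
  apply: eq_bigr => i _; rewrite linearZ mxE /GRing.scale/=; congr (_ * _).
  rewrite -[l1 _ _]/(L2 (delta_mx 0 i) v) [in LHS](row_sum_delta v) linear_sum.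
  by apply: eq_bigr => j _; rewrite linearZ !mxE mulrC.
have uA x : U x -> A x \in unitmx.
  move=> Ux; rewrite -row_free_unit -kermx_eq0; apply/eqP/row_matrixP => i.
  rewrite row0; apply: (omN x Ux) => v; rewrite omA//.
  have /sub_kermxP -> : (row i (kermx (A x)) <= kermx (A x))%MS by exact: row_sub.
  by rewrite mul0mx mxE.
exists (fun x => (\row_i 'd h x (delta_mx 0 i)) *m (invmx (A x))^T); split.
  move=> i k.
  apply: (@Ck_ext _ _ _ oU _ _
    (fun x => \sum_j 'd h x (delta_mx 0 j) * invmx (A x) i j : R^o)).
    by move=> x Ux; rewrite mxE; apply: eq_bigr => j _; rewrite !mxE.
  apply: (Ck_sum oU) => j _; apply: (CkM oU); first by have [_] := hC k.+1; apply.
  by apply: (Ck_invmx _ _ oU) => // a b; apply: Ck_ext (omC (delta_mx 0 a) (delta_mx 0 b) k) => // x _; rewrite mxE.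
move=> x Ux v; rewrite omA// trmx_mul trmxK -mulmxA mulKVmx ?uA//.
rewrite [v in 'd h x v]row_sum_delta linear_sum mxE; apply: eq_bigr => i _.
by rewrite linearZ !mxE.
Qed.

End LocalHamiltonian.
(** * Charts and transition maps *)

Section Charts.
Context {R : realType} {m : nat} {M : manifold R m}.
Local Notation E := 'rV[R]_m.
Implicit Types (c : chart R m M) (p q : M) (x u v w : E).

Lemma chart_invK c x : atlas c -> chart_im c x ->
  chart_dom c (chart_inv c x) /\ c (chart_inv c x) = x.
Proof. by move=> /atlas_chart[_ _ _ _ cK] [q cq <-]; rewrite cK. Qed.

Lemma chartK c p : chart_at p c -> chart_inv c (c p) = p.
Proof. by move=> [/atlas_chart[_ _ _ _ cK] cp]; exact: cK. Qed.

Lemma chart_at_im c p : chart_at p c -> chart_im c (c p).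
Proof. by move=> [_ cp]; exists p. Qed.

Lemma chart_at_inv c x : atlas c -> chart_im c x -> chart_at (chart_inv c x) c.
Proof. by move=> ca cx; have [] := chart_invK ca cx. Qed.

Lemma open_chart_im c : atlas c -> open (chart_im c).
Proof. by move=> /atlas_chart[]. Qed.

Lemma chart_inv_cont c x : atlas c -> chart_im c x -> {for x, continuous (chart_inv c)}.
Proof. by move=> /atlas_chart[_ _ _ cc _] cx; exact: cc. Qed.

Lemma open_chart_preim c (A : set M) : atlas c -> open A ->
  open (chart_im c `&` chart_inv c @^-1` A).
Proof.
move=> ca oA; rewrite openE => x [cx Ax].
apply: filterI; first exact: (open_nbhs_nbhs (conj (open_chart_im ca) cx)).
apply: (chart_inv_cont ca cx); exact: (open_nbhs_nbhs (conj oA Ax)).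
Qed.

(** The open set of coordinates in [c] on which the transition map to [c'] is
    smooth. *)
Definition overlap c c' : set E := c @` (chart_dom c `&` chart_dom c').

Lemma overlapE c c' : atlas c ->
  overlap c c' = chart_im c `&` chart_inv c @^-1` chart_dom c'.
Proof.
move=> ca; apply/seteqP; split => [_ [q [cq c'q] <-]|x [cx c'x]].
  by split; [exists q|rewrite /= chartK].
have [dx <-] := chart_invK ca cx.
by exists (chart_inv c x).
Qed.

Lemma open_overlap c c' : atlas c -> atlas c' -> open (overlap c c').
Proof.
move=> ca c'a; rewrite overlapE//; apply: open_chart_preim => //.
by have [] := atlas_chart c'a.
Qed.

Lemma overlap_at c c' p : chart_at p c -> chart_at p c' -> overlap c c' (c p).
Proof. by move=> [_ cp] [_ c'p]; exists p. Qed.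

Lemma smooth_transition c c' : atlas c -> atlas c' ->
  smooth_on (overlap c c') (transition c c').
Proof. by move=> ca c'a; have [] := atlas_compatible ca c'a. Qed.

Lemma diff_transition c c' x : atlas c -> atlas c' -> overlap c c' x ->
  differentiable (transition c c') x.
Proof. by move=> ca c'a ox; have [+ _] := smooth_transition ca c'a 1; apply. Qed.

Lemma transition_chart c c' p : chart_at p c -> transition c c' (c p) = c' p.
Proof. by move=> cp; rewrite /transition /= chartK. Qed.

(** The two transition maps are inverse to each other near [c p], so the chain
    rule applies to the identity. *)
Lemma change_coordK c c' p u : chart_at p c -> chart_at p c' ->
  change_coord c' c p (change_coord c c' p u) = u.
Proof.
move=> cp c'p; have [ca _] := cp; have [c'a _] := c'p.
have d1 := diff_transition ca c'a (overlap_at cp c'p).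
have d2 := diff_transition c'a ca (overlap_at c'p cp).
have d2' : differentiable (transition c' c) (transition c c' (c p)).
  by rewrite transition_chart.
have cE := congr1 (fun f => f u) (diff_comp d1 d2').
rewrite /change_coord -(transition_chart c' cp) -[LHS]cE.
have iid : is_diff (c p) (transition c' c \o transition c c') id.
  apply: near_eq_is_diff (is_diff_id (c p)).
  near=> x; have : overlap c c' x.
    near: x; apply: open_nbhs_nbhs; split; [exact: open_overlap|exact: overlap_at].
  move=> [q [cq c'q] <-]; rewrite /= transition_chart// transition_chart//.
by have [_ ->] := iid.
Unshelve. all: by end_near. Qed.

End Charts.

(** * Failure of coisotropy in a slice chart *)

Section Slice.
Context {R : realType} {m : nat} {M : manifold R m}.
Local Notation E := 'rV[R]_m.
Implicit Types (c : chart R m M) (p q : M) (x u v w : E) (om : cotensor2 M).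

Lemma cotensor2_linear om p c : is_cotensor2 om -> chart_at p c -> forall a u v w,
  om c p (a *: u + v) w = a * om c p u w + om c p v w /\
  om c p w (a *: u + v) = a * om c p w u + om c p w v.
Proof. by move=> [oL _ _] cp a u v w; exact: oL. Qed.

Lemma cotensor2_0r om p c u : is_cotensor2 om -> chart_at p c -> om c p u 0 = 0.
Proof.
move=> oT cp; have [_] := cotensor2_linear oT cp 1 0 0 u; rewrite scale1r addr0 mul1r => /eqP.
by rewrite -subr_eq0 opprD addrA subrr sub0r oppr_eq0 => /eqP.
Qed.

Lemma cotensor2_Zr om p c a u v : is_cotensor2 om -> chart_at p c ->
  om c p u (a *: v) = a * om c p u v.
Proof.
move=> oT cp; have [_] := cotensor2_linear oT cp a v 0 u.
by rewrite addr0 cotensor2_0r// addr0.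
Qed.

(** By polarization of [om u u = 0]. *)
Lemma symplectic_antisym om p c u v : symplectic_form om -> chart_at p c ->
  om c p u v = - om c p v u.
Proof.
move=> [oT alt _ _] cp; have oL := cotensor2_linear oT cp.
have Dl a b w : om c p (a + b) w = om c p a w + om c p b w.
  by have := (oL 1 a b w).1; rewrite scale1r mul1r.
have Dr a b w : om c p w (a + b) = om c p w a + om c p w b.
  by have := (oL 1 a b w).2; rewrite scale1r mul1r.
have := alt p c cp (u + v); rewrite Dl !Dr !alt// add0r addr0 => /eqP.
by rewrite addr_eq0 => /eqP.
Qed.

Definition slice (k : nat) (N : set M) c := forall q, chart_dom c q ->
  N q <-> (forall i : 'I_m, (k <= i)%N -> c q 0 i = 0).

(** In a slice chart these are the coordinates of the vectors tangent to the
    submanifold. *)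
Definition slice_vector (k : nat) (w : E) := forall i : 'I_m, (k <= i)%N -> w 0 i = 0.

(** The straight segment in the slice chart is a smooth curve in [N]; in any
    other chart its velocity is transformed by the differential of the
    transition map. *)
Lemma slice_tangent k (N : set M) c c0 p w : N p -> chart_at p c -> chart_at p c0 ->
  slice k N c0 -> slice_vector k w -> tangent_space N c p (change_coord c0 c p w).
Proof.
move=> Np cp c0p sN wf; have [ca _] := cp; have [c0a c0d] := c0p.
have al t : is_diff (t : R^o) (fun s : R^o => c0 p + s *: w) (fun s => s *: w).
  split; first by apply/derivable1_diffP; have [] := is_derive_line (c0 p) w t.
  have [d D] := is_derive_line (c0 p) w t.
  by rewrite deriv1E// derive1E D.
have ca0 : continuous (fun s : R^o => c0 p + s *: w).
  by move=> s; apply: differentiable_continuous; have [] := al s.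
have oU := open_overlap c0a ca.
have [e e0 eU] : exists2 e : R, 0 < e & forall t, `|t| < e -> overlap c0 c (c0 p + t *: w).
  have : nbhs (0 : R^o) ((fun s : R^o => c0 p + s *: w) @^-1` overlap c0 c).
    apply: ca0; rewrite scale0r addr0; apply: open_nbhs_nbhs; split => //.
    exact: overlap_at.
  move=> /nbhs_ballP[e /= e0 eU]; exists e => // t te; apply: eU.
  by rewrite -ball_normE /= sub0r normrN.
exists (fun t => chart_inv c0 (c0 p + t *: w)), e; split => //.
- by rewrite scale0r addr0 chartK.
- move=> t /eU; rewrite overlapE// => -[x1 x2]; split => //.
  have [d E0] := chart_invK c0a x1.
  apply/(sN _ d) => i ki; rewrite E0 !mxE wf// mulr0 addr0.
  by move/(sN _ c0d) : Np; exact.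
- move=> j.
  apply: (@Ck_sub _ _ _ _ ((fun s : R^o => c0 p + s *: w) @^-1` overlap c0 c)).
    by move=> t /=; exact: eU.
  apply: (Ck_comp_affine (f := transition c0 c) _ al).
    by apply: open_comp => // s _; exact: ca0.
  exact: smooth_transition.
- have dl := is_derive_line (c0 p) w 0.
  have E0 : c0 p + (0 : R) *: w = c0 p by rewrite scale0r addr0.
  have := @is_derive_diff_comp _ _ _ (fun s : R => c0 p + s *: w) (transition c0 c) 0 w dl.
  rewrite E0 => /(_ (diff_transition c0a ca (overlap_at c0p cp))) [_ D].
  by rewrite derive1E; exact: D.
Qed.

(** Coisotropy may fail in a chart unrelated to [N]. The witness is carried to a
    slice chart at the same point, where membership in the tangent space can be
    read on the coordinates: orthogonality is transported by invariance of [om],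
    and a transported vector with vanishing last coordinates would be tangent by
    [slice_tangent]. *)
Lemma noncoisotropic_slice om k (N : set M) :
  symplectic_form om -> embedded_submanifold k N -> ~ coisotropic om N ->
  exists p c v, [/\ N p, chart_at p c, slice k N c,
    forall w, slice_vector k w -> om c p w v = 0 & ~ slice_vector k v].
Proof.
move=> omS [_ Nemb] /existsNP[p] /not_implyP[Np] /existsNP[c] /not_implyP[cp].
move=> /existsNP[v] /not_implyP[vo vT].
have [c0 c0p sN] := Nemb p Np.
have [oT _ _ _] := omS; have [_ oI _] := oT.
exists p, c0, (change_coord c c0 p v); split => // [w wf|vf].
  rewrite symplectic_antisym// -[w](change_coordK _ c0p cp) oI// vo ?oppr0//.
  exact: (slice_tangent Np cp c0p sN wf).
apply: vT; rewrite -[v](change_coordK _ cp c0p).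
exact: (slice_tangent Np cp c0p sN vf).
Qed.

End Slice.
(** * Bounds on the Hofer norm *)

Section Oscillation.
Context {R : realType} {m : nat} {M : manifold R m}.

(** The lower bound holds because the range is bounded: for unbounded sets [sup]
    and [inf] have default values, and the difference could be negative. *)
Lemma oscillation_bounds (h : M -> R) (C : R) : 0 <= C ->
  (forall q, `|h q| <= C) -> 0 <= oscillation h <= 2 * C.
Proof.
move=> C0 hC; rewrite /oscillation; have [[p _]|M0] := pselect (exists p : M, True); last first.
  have -> : range h = set0.
    by apply/seteqP; split => // x [q _ _]; case: M0; exists q.
  by rewrite sup0 inf0 subrr lexx/= mulr_ge0.
have rp : range h (h p) by exists p.
have ubh : ubound (range h) C by move=> _ [q _ <-]; have := hC q; rewrite ler_norml => /andP[].
have lbh : lbound (range h) (- C) by move=> _ [q _ <-]; have := hC q; rewrite ler_norml => /andP[].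
have h1 : h p <= sup (range h) by apply: ub_le_sup => //; exists C.
have h2 : inf (range h) <= h p by apply: ge_inf => //; exists (- C).
have h3 : sup (range h) <= C by apply: ge_sup => //; exists (h p).
have h4 : - C <= inf (range h) by apply: lb_le_inf => //; exists (h p).
by apply/andP; split; lra.
Qed.

(** Continuity of each [H t] is read off the local smooth extensions; the time
    slice of the compact support is contained in its projection to [M]. *)
Lemma hamiltonian_bounded (H : R -> M -> R) t : smooth_hamiltonian H ->
  compactly_supported H -> t \in `[0, 1] -> exists2 C, 0 <= C & forall q, `|H t q| <= C.
Proof.
move=> Hs Hc t01; pose S := snd @` closure [set z : R * M | z.1 \in `[0, 1] /\ H z.1 z.2 != 0].
have cS : compact S.
  apply: continuous_compact => //; apply: continuous_subspaceT => z; exact: cvg_snd.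
have cH : continuous (H t).
  move=> p; have [c ca cp] := atlas_cover p.
  have [_ _ cc _ cK] := atlas_chart ca.
  have [W [F [oW Wp Fs FE]]] := Hs c ca t (c p) t01 (chart_at_im (conj ca cp)).
  have cF : {for (t, c p), continuous F}.
    by apply: differentiable_continuous; have [+ _] := Fs 1; apply.
  have cpair : (fun q : M => (t : R^o, c q : 'rV[R]_m)) @ p --> ((t : R^o), (c p : 'rV[R]_m)).
    exact: (@cvg_pair _ _ _ (nbhs p) (nbhs (t : R^o)) (nbhs (c p)) _ _ _ (fun=> t) c
      (cvg_cst _) (cc p cp)).
  have E : \forall q \near p, F (t, c q) = H t q.
    near=> q; have cq : chart_dom c q.
      by near: q; apply: open_nbhs_nbhs; split => //; have [] := atlas_chart ca.
    rewrite FE ?cK//; last exact: chart_at_im (conj ca cq).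
    near: q; apply: cpair; exact: open_nbhs_nbhs.
  have := cvg_comp _ _ cpair cF; rewrite [F (t, c p)](nbhs_singleton E).
  by apply: cvg_trans; apply: near_eq_cvg.
have : compact (H t @` S) by apply: continuous_compact => //; exact: continuous_subspaceT.
move=> /compact_bounded[C [_ CP]]; exists (`|C| + 1) => [|q]; first by rewrite addr_ge0.
have [->|Hq] := eqVneq (H t q) 0; first by rewrite normr0 addr_ge0.
apply: (CP (`|C| + 1)); first by rewrite (le_lt_trans (ler_norm C))// ltrDl.
exists q => //; exists (t, q) => //; exact: subset_closure.
Unshelve. all: by end_near. Qed.

Lemma chekanov_hofer_ge0 (om : cotensor2 M) (N0 N1 : set M) :
  (0 <= chekanov_hofer om N0 N1)%E.
Proof.
apply: le_ereal_inf_tmp => _ [phi _ <-].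
apply: le_ereal_inf_tmp => _ [H [Hs Hc _] <-].
apply: integral_ge0 => t t01; rewrite lee_fin.
have [|C C0 HC] := hamiltonian_bounded Hs Hc (t := t); first by rewrite inE in t01 *.
by have /andP[] := oscillation_bounds C0 HC.
Qed.

Lemma hofer_norm_autonomous (om : cotensor2 M) (h : M -> R) phi C :
  0 <= C -> generates om (fun=> h) phi -> (forall q, `|h q| <= C) ->
  (hofer_norm om phi <= (2 * C)%:E)%E.
Proof.
move=> C0 hg hC; apply: ge_ereal_inf.
exists (\int[lebesgue_measure]_(t in `[0%R, 1%R]) (oscillation h)%:E)%E.
  by exists (fun=> h).
rewrite integral_cst//= lebesgue_measure_itv/= lte_fin ltr01 oppr0 adde0 mule1.
by rewrite lee_fin; have /andP[] := oscillation_bounds C0 hC.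
Qed.

End Oscillation.
(** * Extension of a chart function by zero *)

Section Extension.
Context {R : realType} {m : nat} {M : manifold R m}.
Local Notation E := 'rV[R]_m.
Variables (c0 : chart R m M) (x0 : E) (r : R).
Hypothesis c0a : atlas c0.
Hypothesis rU : cube x0 r `<=` chart_im c0.

Definition extend (k : E -> R) (q : M) : R :=
  if `[< chart_dom c0 q >] then k (c0 q) else 0.

(** The part of the manifold where extended functions may be nonzero; it is
    compact, hence closed in the Hausdorff space [M]. *)
Definition chart_cube (q : M) := chart_dom c0 q /\ cube x0 r (c0 q).

Lemma extend_in k q : chart_dom c0 q -> extend k q = k (c0 q).
Proof. by move=> cq; rewrite /extend asboolT. Qed.

Lemma chart_cubeE : chart_cube = chart_inv c0 @` cube x0 r.
Proof.
apply/seteqP; split => [q [cq rq]|_ [x xr <-]].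
  by exists (c0 q) => //; rewrite chartK.
by have [d E0] := chart_invK c0a (rU xr); split => //; rewrite E0.
Qed.

Lemma chart_cube_compact : compact chart_cube.
Proof.
rewrite chart_cubeE; apply: continuous_compact; last exact: cube_compact.
apply: continuous_in_subspaceT => x; rewrite inE => xr.
exact: chart_inv_cont c0a (rU xr).
Qed.

Lemma chart_cube_closed : closed chart_cube.
Proof. apply: compact_closed; [exact: manifold_hausdorff|exact: chart_cube_compact]. Qed.

Section OneFunction.
Variable k : E -> R^o.
Hypothesis ks : smooth_on setT k.
Hypothesis k0 : forall x, ~ cube x0 r x -> k x = 0.

Lemma extend_out q : ~ chart_cube q -> extend k q = 0.
Proof.
move=> qr; rewrite /extend; case: asboolP => // cq; apply: k0 => rq.
exact: qr.
Qed.

(** Away from the domain of [c0], the extended function vanishes on the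
    complement of [chart_cube], an open set; elsewhere it is [k] composed with a
    transition map. *)
Lemma extend_local c x : atlas c -> chart_im c x ->
  exists W : set E, [/\ open W, W x & smooth_on W (extend k \o chart_inv c : E -> R^o)].
Proof.
move=> ca cx; have [qd|qd] := pselect (chart_dom c0 (chart_inv c x)).
  have oW := open_overlap ca c0a.
  exists (overlap c c0); split => //; first by rewrite overlapE.
  move=> j; apply: (@Ck_ext _ _ _ oW _ _ (k \o transition c c0)).
    by move=> y; rewrite overlapE// => -[_ cy]; rewrite /= extend_in.
  apply: (@Ck_comp _ _ _ _ _ _ setT _ _ oW) => //.
  exact: smooth_transition.
have oW : open (chart_im c `&` chart_inv c @^-1` ~` chart_cube).
  by apply: open_chart_preim => //; exact/closed_openC/chart_cube_closed.
exists (chart_im c `&` chart_inv c @^-1` ~` chart_cube); split => //.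
  by split => //= -[].
move=> j; apply: (@Ck_ext _ _ _ oW _ _ (fun=> 0)); last exact: Ck_cst.
by move=> y [_ yr]; rewrite /= extend_out.
Qed.

(** As the Hamiltonian does not depend on time, the required extension to an
    open subset of [R x E] is obtained by composing with the second projection.
    *)
Lemma extend_smooth : smooth_hamiltonian (fun _ : R => extend k).
Proof.
move=> c ca t x _ cx; have [W [oW Wx Ws]] := extend_local ca cx.
have snd_diff z : is_diff z (snd : R^o * E -> E) snd.
  have sl : linear (snd : R^o * E -> E) by [].
  pose l : {linear (R^o * E)%type -> E} := HB.pack (snd : R^o * E -> E) (GRing.isLinear.Build _ _ _ _ _ sl).
  have cl : continuous l by move=> y; exact: cvg_snd.
  by split; [exact: (linear_differentiable z cl)|exact: (diff_lin z cl)].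
have oW' : open ((snd : R^o * E -> E) @^-1` W).
  by apply: open_comp => // z _; exact: cvg_snd.
exists (snd @^-1` W), ((extend k \o chart_inv c) \o snd); split => //.
by move=> j; exact: (Ck_comp_affine oW' snd_diff (Ws j)).
Qed.

Lemma extend_compactly_supported : compactly_supported (fun _ : R => extend k).
Proof.
have cK : compact ([set` `[(0 : R), 1]] `*` chart_cube).
  by apply: compact_setX; [exact: segment_compact|exact: chart_cube_compact].
apply: (subclosed_compact _ cK); first exact: closed_closure.
have clK : closed ([set` `[(0 : R), 1]] `*` chart_cube).
  apply: (@closedI _ (fst @^-1` [set` `[(0 : R), 1]]) (snd @^-1` chart_cube)).
    by apply: closed_comp => [z _|]; [exact: cvg_fst|exact: interval_closed].
  by apply: closed_comp => [z _|]; [exact: cvg_snd|exact: chart_cube_closed].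
rewrite [X in _ `<=` X]((closure_id _).1 clK); apply: closure_subset => -[t q] /= [t01 qk].
split => //=; apply: contrapT => /extend_out qr; by rewrite qr eqxx in qk.
Qed.

Variable om : cotensor2 M.
Hypothesis omS : symplectic_form om.

(** A Hamiltonian vector in the chart [c0] transforms into one in any other
    chart: this combines the invariance of [om] with the chain rule for the
    transition map. *)
Lemma extend_vector c q z : chart_at q c -> chart_dom c0 q ->
  (forall v, om c0 q v z = 'd k (c0 q) v) ->
  hamiltonian_vector om (extend k) c q (change_coord c0 c q z).
Proof.
move=> cq c0d zE v; have [[_ oI _] _ _ _] := omS; have [ca cd] := cq.
have c0q : chart_at q c0 by [].
have <- : change_coord c0 c q (change_coord c c0 q v) = v by exact: change_coordK.
rewrite (oI q c0 c c0q cq) zE change_coordK//.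
have dT := diff_transition ca c0a (overlap_at cq c0q).
have dk : differentiable k (transition c c0 (c q)) by have [+ _] := ks 1; apply.
have D := diff_comp dT dk.
have pE : is_diff (c q) (extend k \o chart_inv c : E -> R^o) ('d (k \o transition c c0) (c q)).
  apply: near_eq_is_diff (differentiableP (differentiable_comp dT dk)).
  near=> y; have : overlap c c0 y.
    near: y; apply: open_nbhs_nbhs; split; [exact: open_overlap|exact: overlap_at].
  by rewrite overlapE// => -[_ cy]; rewrite /= extend_in.
transitivity ('d (k \o transition c c0) (c q) v).
  have Dv := congr1 (fun f : E -> R^o => f v) D.
  symmetry; apply: etrans Dv _; rewrite /change_coord.
  change ('d k (transition c c0 (c q)) ('d (transition c c0) (c q) v) =
    'd k (c0 q) ('d (transition c c0) (c q) v)).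
  by have -> : transition c c0 (c q) = c0 q by exact: transition_chart.
case: pE => _ pE; exact: (esym (congr1 (fun f : E -> R^o => f v) pE)).
Unshelve. all: by end_near. Qed.

Lemma extend_vector0 c q : chart_at q c -> ~ chart_cube q ->
  hamiltonian_vector om (extend k) c q 0.
Proof.
move=> cq qr v; have [oT _ _ _] := omS; have [ca cd] := cq.
rewrite cotensor2_0r//.
have oW : open (chart_im c `&` chart_inv c @^-1` ~` chart_cube).
  by apply: open_chart_preim => //; exact/closed_openC/chart_cube_closed.
have pE : is_diff (c q) (extend k \o chart_inv c : E -> R^o) 0.
  apply: near_eq_is_diff (is_diff_cst 0 (c q)).
  near=> y; have : (chart_im c `&` chart_inv c @^-1` ~` chart_cube) y.
    near: y; apply: open_nbhs_nbhs; split; first exact: oW.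
    by split; [exact: chart_at_im|rewrite /= chartK].
  by move=> [_ yr]; rewrite /= extend_out.
by have [_ ->] := pE.
Unshelve. all: by end_near. Qed.

End OneFunction.
End Extension.
(** * Flows of functions of a conserved Hamiltonian *)

Section Flow.
Context {R : realType} {m : nat} {M : manifold R m}.
Local Notation E := 'rV[R]_m.
Variables (om : cotensor2 M) (c0 : chart R m M) (x0 : E) (r r' T : R).
Variables (h : E -> R^o) (X : E -> E) (gam : E -> R -> E).
Hypothesis omS : symplectic_form om.
Hypothesis c0a : atlas c0.
Hypothesis rU : cube x0 r `<=` chart_im c0.
Hypothesis rr' : cube x0 r' `<=` cube x0 r.
Hypothesis hs : smooth_on setT h.
Hypothesis h0 : forall x, ~ cube x0 r' x -> h x = 0.
(* [X] is the Hamiltonian field of [h] in the chart, and [gam y] its integral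
   curve through [y]. *)
Hypothesis XE : forall x, chart_im c0 x -> forall v, om c0 (chart_inv c0 x) v (X x) = 'd h x v.
Hypothesis T0 : 0 < T.
Hypothesis gam0 : forall y, cube x0 r' y -> gam y 0 = y.
Hypothesis gamE : forall y, cube x0 r' y -> forall t, `|t| < T ->
  cube x0 r (gam y t) /\ is_derive t (1 : R) (gam y) (X (gam y t)).

Let r'U : cube x0 r' `<=` chart_im c0.
Proof. by move=> x /rr'/rU. Qed.

Lemma diff_h x : differentiable h x.
Proof. by have [+ _] := hs 1; apply. Qed.

(** The derivative of [h] along its integral curve is [om X X = 0]. *)
Lemma energy_conservation y t : cube x0 r' y -> `|t| < T -> h (gam y t) = h y.
Proof.
move=> yr tT; rewrite -[in RHS](gam0 yr).
have dh s : `|s| < T -> is_derive s (1 : R) (h \o gam y : R -> R) 0.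
  move=> sT; have [gr dg] := gamE yr sT.
  have := is_derive_diff_comp dg (diff_h (gam y s)).
  rewrite -(XE (rU gr)); have [_ alt _ _] := omS.
  by rewrite alt//; apply: chart_at_inv => //; exact: rU.
apply/eqP; rewrite -subr_eq0 -normr_le0.
have bnd a b : a <= b -> `|a| < T -> `|b| < T ->
    `|(h \o gam y) b - (h \o gam y) a| <= 0 * (b - a).
  move=> ab aT bT; apply: (@mean_value_ineq1 _ _ (fun=> 0)) => // [s /andP[sa sb]|s _].
    apply: dh; move: aT bT; rewrite !ltr_norml => /andP[a1 _] /andP[_ b2].
    by rewrite (lt_le_trans a1)//= (le_lt_trans sb).
  by rewrite normr0.
have [t0|/ltW t0] := leP 0 t.
  by have := bnd 0 t t0; rewrite normr0 mul0r; apply.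
by have := bnd t 0 t0; rewrite normr0 mul0r distrC; apply.
Qed.

Section Profile.
Variables f df : R -> R.
Hypothesis fs : smooth_on setT (f : R^o -> R^o).
Hypothesis fE : forall s, is_derive s (1 : R) f (df s).
Hypothesis f0 : f 0 = 0.
Hypothesis dfT : forall s, `|df s| < T.

(** The flow of [f \o h], where [df] is the derivative of [f]: the integral
    curve of the field of [h], run at the speed [df (h q)] given by its starting
    point. Points outside the cube [r'], where the Hamiltonian vanishes, do not
    move. *)
Definition profile_flow (t : R) (q : M) : M :=
  if `[< chart_cube c0 x0 r' q >] then chart_inv c0 (gam (c0 q) (t * df (h (c0 q)))) else q.

Let k : E -> R^o := f \o h.

Lemma profile_smooth : smooth_on setT k.
Proof. by move=> j; apply: (@Ck_comp1 _ _ _ _ _ setT) => //; exact: openT. Qed.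

Lemma profile_out x : ~ cube x0 r' x -> k x = 0.
Proof. by move=> /h0 hx; rewrite /k /= hx. Qed.

Lemma profile_diff x v : 'd k x v = df (h x) * 'd h x v.
Proof.
have D := is_diff_comp (differentiableP (diff_h x)) (is_derive_is_diff (fE (h x))).
by have [_ ->] := D; rewrite /= mulrC.
Qed.

Lemma time_lt y (t : R) : t \in `[0, 1] -> `|t * df (h y)| < T.
Proof.
rewrite in_itv/= => /andP[t0 t1]; rewrite normrM ger0_norm//.
by apply: le_lt_trans (dfT (h y)); rewrite ler_piMl.
Qed.

Lemma is_derive_profile y (t : R) : cube x0 r' y -> t \in `[0, 1] ->
  is_derive t (1 : R) (fun s => gam y (s * df (h y)))
    (df (h y) *: X (gam y (t * df (h y)))).
Proof.
move=> yr t01; have [gr dg] := gamE yr (time_lt y t01).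
have dl : is_derive t (1 : R) (fun s : R => s * df (h y)) (df (h y)).
  have -> : (fun s : R => s * df (h y)) = (fun s => df (h y) * s).
    by apply/funext => s; rewrite mulrC.
  exact: is_derive_scale.
have dd : differentiable (gam y) (t * df (h y)) by apply/derivable1_diffP; case: dg.
have := is_derive_diff_comp dl dd.
rewrite deriv1E; last by case: dg.
by rewrite derive1E; case: dg => _ ->.
Qed.

(** The field of [f \o h] is [df (h) X]. By [energy_conservation] the factor
    keeps its initial value along each integral curve of [X], so reparametrizing
    these curves linearly gives those of [f \o h]. *)
Lemma profile_isotopy : hamiltonian_isotopy om (fun=> extend c0 k) profile_flow.
Proof.
move=> p; have [pr|pr] := pselect (chart_cube c0 x0 r' p); last first.
  have flE t : profile_flow t p = p by rewrite /profile_flow asboolF.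
  have -> : profile_flow^~ p = (fun=> p) by apply/funext.
  split => //; first by move=> ?; exact: cvg_cst.
  move=> t t01 c; rewrite flE => cp; exists 0.
    exact: (extend_vector0 c0a r'U profile_out omS).
  under eq_fun do rewrite !flE subrr scaler0.
  exact: cvg_cst.
have [c0p yr] := pr; set y := c0 p in yr.
have flE t : profile_flow t p = chart_inv c0 (gam y (t * df (h y))).
  by rewrite /profile_flow asboolT.
have inU t : t \in `[0, 1] -> chart_im c0 (gam y (t * df (h y))).
  by move=> t01; apply: rU; have [] := gamE yr (time_lt y t01).
split.
- by rewrite flE mul0r gam0// chartK.
- have -> : profile_flow^~ p = chart_inv c0 \o (fun t => gam y (t * df (h y))).
    by apply/funext.
  apply: continuous_in_subspaceT => t; rewrite inE/= => t01.
  apply: continuous_comp; last exact: chart_inv_cont c0a (inU t t01).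
  apply: differentiable_continuous; apply/derivable1_diffP.
  by have [] := is_derive_profile yr t01.
- move=> t t01 c; rewrite flE; set q := chart_inv c0 _ => cq.
  have [d0 Eq] := chart_invK c0a (inU t t01).
  have [ca _] := cq; have c0q : chart_at q c0 by [].
  exists (change_coord c0 c q (df (h y) *: X (gam y (t * df (h y))))).
    apply: (extend_vector c0a profile_smooth omS cq d0) => v.
    have oT : is_cotensor2 om by case: omS.
    rewrite cotensor2_Zr// (XE (inU t t01)) /q Eq profile_diff energy_conservation//.
    exact: time_lt.
  have dg := is_derive_profile yr t01.
  have dtr : differentiable (transition c0 c) (gam y (t * df (h y))).
    by apply: diff_transition => //; rewrite -Eq; exact: overlap_at.
  have [D1 D2] := is_derive_diff_comp dg dtr.
  apply: cvg_within_filter.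
  have -> : change_coord c0 c q (df (h y) *: X (gam y (t * df (h y)))) =
     'D_1 (transition c0 c \o (fun s => gam y (s * df (h y)))) t.
    by rewrite D2 /change_coord Eq.
  rewrite (_ : (fun e => _) = (fun e => e^-1 *:
      (((transition c0 c \o (fun s => gam y (s * df (h y)))) \o shift t) (e *: (1 : R))
       - (transition c0 c \o (fun s => gam y (s * df (h y)))) t))); first exact: D1.
  apply/funext => e; rewrite !flE /= /transition /=.
  by rewrite [e *: _]mulr1 [e + t]addrC.
Qed.

Lemma generates_profile : generates om (fun=> extend c0 k) (profile_flow 1).
Proof.
split.
- exact: (extend_smooth c0a r'U profile_smooth profile_out).
- exact: (extend_compactly_supported c0a r'U profile_out).
- by exists profile_flow => //; exact: profile_isotopy.
Qed.

End Profile.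
End Flow.
(** * Non-rigidity of non-coisotropic submanifolds *)

Section Main.
Context {R : realType}.

(** Uniformly of size [|s| e], but with derivative [s] at the origin for every
    [e]; this is what makes the displacement of the zero set of [h] independent
    of [e]. *)
Definition wave (s e : R) (t : R) : R := s * e * sin (e^-1 * t).

Lemma wave_smooth s e : smooth_on setT (wave s e : R^o -> R^o).
Proof.
move=> k; apply: (CkM openT (Ck_cst openT k (s * e : R^o))).
apply: (@Ck_comp1 _ R^o R^o k setT setT (fun t => e^-1 * t) sin openT) => //.
  apply: (CkM openT (Ck_cst openT k (e^-1 : R^o))).
  case: k => [//|k]; apply: (@Ck_deriv _ k id (fun=> 1)).
  exact: (Ck_cst openT k (1 : R^o)).
by have [] := @Ck_sin_cos R k.
Qed.

Lemma is_derive_wave s e t : 0 < e ->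
  is_derive t (1 : R) (wave s e) (s * cos (e^-1 * t)).
Proof.
move=> e0; have en0 : e != 0 by rewrite gt_eqF.
have dc := is_derive1_comp (is_derive_sin (e^-1 * t)) (is_derive_scale e^-1 t).
apply: is_derive_eq (is_deriveZ (s * e) dc) _.
by rewrite /GRing.scale/=; field.
Qed.

Lemma wave_le s e t : 0 < e -> `|wave s e t| <= `|s| * e.
Proof.
move=> e0; rewrite /wave !normrM (gtr0_norm e0) ler_piMr ?mulr_ge0 ?(ltW e0)//.
by rewrite ler_norml sin_geN1 sin_le1.
Qed.

Context {m : nat} {M : manifold R m}.
Local Notation E := 'rV[R]_m.

(** All the maps [phi e] displace [N] in the same way, while their Hofer norms
    are at most [2 |s| e]. *)
Theorem not_CH_rigid k (om : cotensor2 M) (N : set M) :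
  symplectic_form om -> embedded_submanifold k N -> ~ coisotropic om N ->
  ~ CH_rigid om N.
Proof.
move=> omS Nemb Nco.
have [p [c0 [v [Np c0p sN vo vf]]]] := noncoisotropic_slice omS Nemb Nco.
have [c0a c0d] := c0p; have [oT alt _ nondeg] := omS.
pose x0 := c0 p.
have [r r0 rU] : exists2 r : R, 0 < r & cube x0 r `<=` chart_im c0.
  have : nbhs x0 (chart_im c0).
    by apply: open_nbhs_nbhs; split; [exact: open_chart_im|exact: chart_at_im].
  move=> /nbhs_ballP[e /= e0 eU]; exists (e / 2); first by rewrite divr_gt0.
  move=> x /= xr; apply: eU; rewrite -ball_normE /= distrC.
  by apply: le_lt_trans xr _; rewrite ltr_pdivrMr// ltr_pMr// ltr1n.
pose r' := r / 2; have r'0 : 0 < r' by rewrite divr_gt0.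
have rr' : cube x0 r' `<=` cube x0 r.
  by move=> x /le_trans; apply; rewrite ler_pdivrMr// ler_pMr// ler1n.
have alL : linear (fun u => om c0 p u v : R^o).
  by move=> a u u'; have [] := cotensor2_linear oT c0p a u u' v.
pose al : {linear E -> R^o} :=
  HB.pack (fun u => om c0 p u v : R^o) (GRing.isLinear.Build _ _ _ _ _ alL).
have [h [b [b0 hs h0 hal dh]]] := bump_hamiltonian al x0 r'0.
have [X [Xs XE]] : exists X : E -> E,
    (forall i, smooth_on (chart_im c0) (fun x => X x 0 i : R^o)) /\
    forall x, chart_im c0 x -> forall v, om c0 (chart_inv c0 x) v (X x) = 'd h x v.
  apply: (@smooth_hamiltonian_field _ _ _ (fun x => om c0 (chart_inv c0 x))).
  - exact: open_chart_im.
  - move=> x cx a u u' w; apply: cotensor2_linear => //; exact: chart_at_inv.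
  - by have [_ _] := oT; apply.
  - move=> x cx; apply: nondeg; exact: chart_at_inv.
  - by move=> j; apply: (@Ck_sub _ _ _ _ setT).
have Xx0 : X x0 = b *: v.
  apply/eqP; rewrite -subr_eq0; apply/eqP; apply: (nondeg p c0 c0p) => w.
  rewrite (symplectic_antisym _ _ omS c0p).
  have [_] := cotensor2_linear oT c0p (- b) v (X x0) w; rewrite scaleNr addrC => ->.
  have := XE x0 (chart_at_im c0p) w; rewrite /x0 chartK// => ->.
  by rewrite dh /al/= mulNr addrC subrr oppr0.
have [T [T0 flow]] := local_flow r0 (fun i => Xs i 2) rU.
have /choice[gam gamP] : forall y, exists g : R -> E, cube x0 r' y ->
    g 0 = y /\ forall t, `|t| < T -> cube x0 r (g t) /\ is_derive t (1 : R) g (X (g t)).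
  move=> y; have [yr|yr] := pselect (cube x0 r' y); last by exists (fun=> 0).
  by have [g gP] := flow y yr; exists g.
have x0r' : cube x0 r' x0 by rewrite /cube/= subrr normr0 ltW.
(* If the curve stayed in [N], its last coordinates would vanish and so would
   those of its velocity [b *: v]. *)
have [s sT sN1] : exists2 s, `|s| < T & ~ N (chart_inv c0 (gam x0 s)).
  apply: contrapT => Hs; apply: vf => i ki.
  have [g0 gP] := gamP _ x0r'.
  have gz t : `|t| < T -> gam x0 t 0 i = 0.
    move=> tT; have [gr _] := gP t tT; have [d Eg] := chart_invK c0a (rU _ gr).
    rewrite -Eg; move: i ki; apply/(sN _ d); apply: contrapT => nN.
    by apply: Hs; exists t.
  have T00 : `|0 : R| < T by rewrite normr0.
  have [_ d0] := gP 0 T00.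
  have [_ dz] : is_derive (0 : R) (1 : R) (fun t => gam x0 t 0 i) 0.
    apply: (@near_eq_is_derive _ _ _ (cst (0 : R))).
    near=> t; rewrite gz//; near: t.
  have [_ dX] := (is_derive_rowP _ _ _).1 d0 i.
  move: dX; rewrite dz g0 Xx0 mxE => /esym/eqP.
  by rewrite mulf_eq0 gt_eqF//= => /eqP.
have Nh q : N q -> chart_dom c0 q -> h (c0 q) = 0.
  move=> Nq dq; apply: hal; apply: vo => i ki; rewrite !mxE.
  have /(sN _ dq)/(_ i ki) -> := Nq.
  by have /(sN _ c0d)/(_ i ki) -> := Np; rewrite subrr.
pose H e := extend c0 (wave s e \o h).
pose phi e := profile_flow c0 x0 r' h gam (fun t => s * cos (e^-1 * t)) 1.
have gen e : 0 < e -> generates om (fun=> H e) (phi e).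
  move=> e0; apply: (@generates_profile _ _ _ om c0 x0 r r' T h X gam) => //.
  - by move=> y /gamP[].
  - by move=> y /gamP[].
  - exact: wave_smooth.
  - by move=> t; exact: is_derive_wave.
  - by rewrite /wave mulr0 sin0 mulr0.
  - move=> t; rewrite normrM; apply: le_lt_trans sT; rewrite ler_piMr//.
    by rewrite ler_norml cos_geN1 cos_le1.
have gen0 : generates om (fun=> extend c0 (cst 0 \o h)) id.
  have -> : @id M = profile_flow c0 x0 r' h gam (fun=> 0) 1.
    apply/funext => q; rewrite /profile_flow; case: asboolP => // -[dq qr].
    by rewrite mulr0; have [-> _] := gamP _ qr; rewrite chartK.
  apply: (@generates_profile _ _ _ om c0 x0 r r' T h X gam) => //.
  - by move=> y /gamP[].
  - by move=> y /gamP[].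
  - by move=> j; exact: (Ck_cst openT j (0 : R^o)).
  - by move=> t; rewrite normr0.
have phiN e : phi e @` N = phi 1 @` N.
  apply: eq_imagel => q Nq; rewrite /phi /profile_flow; case: asboolP => // -[dq _].
  by rewrite Nh// !mulr0.
move=> /(_ N (phi 1 @` N)) rigid.
have NN1 : N = phi 1 @` N.
  apply: rigid.
  - exists id; last by rewrite image_id.
    by exists (fun=> extend c0 (cst 0 \o h)).
  - by exists (phi 1) => //; exists (fun=> H 1); exact: gen.
  apply/eqP; rewrite eq_le chekanov_hofer_ge0 andbT.
  apply/lee_addgt0Pr => e e0; rewrite add0e.
  (* With this [d] the bound [2 |s| d] on the Hofer norm is at most [e]; the
     summand 1 avoids dividing by zero. *)
  pose d := e / (2 * (`|s| + 1)).
  have d0 : 0 < d by rewrite divr_gt0 ?mulr_gt0 ?ltr_wpDl.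
  apply: (@le_trans _ _ (hofer_norm om (phi d))).
    by apply: ereal_inf_lbound; exists (phi d) => //; split => //; exists (fun=> H d); exact: gen.
  apply: (@le_trans _ _ (2 * (`|s| * d))%:E).
    apply: (hofer_norm_autonomous _ (gen d d0)); first by rewrite mulr_ge0 ?(ltW d0).
    move=> q; rewrite /H /extend; case: asboolP => _; first exact: wave_le.
    by rewrite normr0 mulr_ge0 ?(ltW d0).
  rewrite lee_fin mulrA /d mulrA ler_pdivrMr ?mulr_gt0 ?ltr_wpDl//.
  by rewrite mulrC ler_wpM2l ?(ltW e0)// ler_pM2l// lerDl.
apply: sN1.
have : N (phi 1 p) by rewrite [X in X _]NN1; exists p.
rewrite /phi /profile_flow asboolT; last by split.
by rewrite Nh// mulr0 cos0 mulr1 mul1r.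
Unshelve. all: by end_near. Qed.

End Main.

Theorem proposition1p3 (R : realType) (m k : nat) (M : manifold R m)
    (om : cotensor2 M) (N : set M)
    (om_symplectic : symplectic_form om)
    (N_submanifold : embedded_submanifold k N) :
  (closed N -> ~ coisotropic om N -> ~ CH_rigid om N) /\
  (compact N -> geometrically_bounded om -> CH_rigid om N -> coisotropic om N).
Proof.
split=> [_ Nco|_ _ rigid]; first exact: (not_CH_rigid om_symplectic N_submanifold Nco).
apply: contrapT => Nco.
exact: (not_CH_rigid om_symplectic N_submanifold Nco rigid).
Qed.
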